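(* Let $m\ge1$, let $f=\sum_{|\alpha|\ge1}a_\alpha X_\alpha$ be a positive regular free holomorphic function and let $\mathcal P$ be a family of noncommutative polynomials with $\mathcal N_{\mathcal P}\ne\{0\}$. An $n$-tuple of operators $T=(T_1,\dots,T_n)\in B(\mathcal H)^n$ is in the noncommutative variety $\mathcal V^m_{f,\mathcal P}(\mathcal H)$ and is pure, i.e., $\Phi_{f,T}^k(I)\to0$ strongly as $k\to\infty$, if and only if there exists a unitary operator $U:\mathcal H\to\mathcal G$ such that $$T_i^*=U^*[(B_i^*\otimes I_{\mathcal D})|_{\mathcal G}]U,\qquad i=1,\dots,n,$$ where $\mathcal D:=\overline{[(id-\Phi_{f,T})^m(I)]^{1/2}(\mathcal H)}$, the (closed) subspace $\mathcal G\subseteq\mathcal N_{\mathcal P}\otimes\mathcal D$ is invariant under each operator $B_i^*\otimes I_{\mathcal D}$, and $(B_1,\dots,B_n)$ is the universal model associated with the noncommutative variety $\mathcal V^m_{f,\mathcal P}$. (In the second condition it is understood that $\sum_{|\alpha|\ge1}a_\alpha T_\alpha T_\alpha^*$ is weakly convergent and $(id-\Phi_{f,T})^m(I)\ge0$, so that $\mathcal D$ is defined.)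
   Context: Let $n\in\mathbb N=\{1,2,\dots\}$. $\mathbb F_n^+$ is the unital free semigroup on generators $g_1,\dots,g_n$ with identity $g_0$; $|\alpha|$ is the word length ($|g_0|=0$). For $X=(X_1,\dots,X_n)\in B(\mathcal H)^n$ ($\mathcal H$ a complex Hilbert space) put $X_\alpha=X_{i_1}\cdots X_{i_k}$ if $\alpha=g_{i_1}\cdots g_{i_k}$ and $X_{g_0}=I$. A positive regular free holomorphic function is a formal series $f=\sum_{\alpha\in\mathbb F_n^+}a_\alpha X_\alpha$ in noncommuting variables with $\limsup_{k\to\infty}(\sum_{|\alpha|=k}|a_\alpha|^2)^{1/2k}<\infty$, $a_\alpha\ge 0$ for all $\alpha$, $a_{g_0}=0$, and $a_{g_i}>0$ for $i=1,\dots,n$. Whenever $\sum_{|\alpha|\ge1}a_\alpha X_\alpha X_\alpha^*$ converges in the weak operator topology (WOT), $\Phi_{f,X}(Y)=\sum_{|\alpha|\ge1}a_\alpha X_\alpha YX_\alpha^*$ for $Y\in B(\mathcal H)$ (WOT convergence). $id$ is the identity map on $B(\mathcal H)$. $\mathbf D_f^m(\mathcal H)$ is the set of $X\in B(\mathcal H)^n$ (with the series above WOT convergent) such that $(id-\Phi_{f,X})^s(I)\ge 0$ for $s=1,\dots,m$, and $\mathcal V^m_{f,\mathcal P}(\mathcal H)=\{X\in\mathbf D_f^m(\mathcal H): p(X_1,\dots,X_n)=0\ \forall p\in\mathcal P\}$. Universal model: $F^2(H_n)=\bigoplus_{k\ge0}(\mathbb C^n)^{\otimes k}$ is the full Fock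 space with orthonormal basis $\{e_\alpha\}_{\alpha\in\mathbb F_n^+}$ ($e_{g_0}=1$). Put $b^{(m)}_{g_0}=1$ and, for $|\alpha|\ge1$, $b^{(m)}_\alpha=\sum_{j=1}^{|\alpha|}\sum_{\gamma_1\cdots\gamma_j=\alpha,\ |\gamma_i|\ge1}a_{\gamma_1}\cdots a_{\gamma_j}\binom{j+m-1}{m-1}$. The weighted left creation operators are $W_ie_\alpha=\sqrt{b^{(m)}_\alpha/b^{(m)}_{g_i\alpha}}\,e_{g_i\alpha}$. Let $\mathcal M_{\mathcal P}=\overline{\mathrm{span}}\{W_\alpha p(W_1,\dots,W_n)W_\beta(1):p\in\mathcal P,\alpha,\beta\in\mathbb F_n^+\}$, $\mathcal N_{\mathcal P}=F^2(H_n)\ominus\mathcal M_{\mathcal P}$, and $B_i=P_{\mathcal N_{\mathcal P}}W_i|_{\mathcal N_{\mathcal P}}$; $(B_1,\dots,B_n)$ is the universal model of $\mathcal V^m_{f,\mathcal P}$. *)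

(* Defs.v *)
From HB Require Import structures.
From mathcomp Require Import all_boot all_order all_algebra.
From mathcomp Require Import complex.
From mathcomp Require Import finmap.
From mathcomp Require Import all_classical all_reals all_analysis.
From mathcomp Require summability.
From mathcomp Require Import ring zify.

Set Implicit Arguments.
Unset Strict Implicit.
Unset Printing Implicit Defensive.

Import Order.TTheory GRing.Theory Num.Theory.
Import numFieldNormedType.Exports.

Local Open Scope classical_set_scope.
Local Open Scope ring_scope.
Local Open Scope complex_scope.

(* `hdot` is linear in its first argument and conjugate-linear in the second. *)
HB.mixin Record CompleteNormedModule_isHilbert (R : realType) H
    & CompleteNormedModule R[i] H := {
  hdot : {dot H for @Num.conj R[i]} ;
  hdot_norm : forall x : H, hdot x x = `|x| ^+ 2
}.

#[short(type="hilbertType")]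
HB.structure Definition Hilbert (R : realType) :=
  {H of CompleteNormedModule R[i] H & CompleteNormedModule_isHilbert R H}.

Section Complex.
Variable R : realType.
Implicit Types (x y z : R[i]).

(* The norm and topology of C go on `R[i]` itself: on `R[i]^o` the key of the
   completeness instance is already taken by `realType`. *)
HB.instance Definition _ := NormedModule.copy R[i] R[i]^o.

Lemma ReB x y : complex.Re (x - y) = complex.Re x - complex.Re y.
Proof. by case: x y => [? ?] []. Qed.

Lemma ImB x y : complex.Im (x - y) = complex.Im x - complex.Im y.
Proof. by case: x y => [? ?] []. Qed.

Lemma normc_Re_le x : `|complex.Re x|%:C <= `|x|.
Proof. exact: normc_ge_Re. Qed.

Lemma normc_i : `|'i%C| = 1 :> R[i].
Proof. by rewrite normc_def /= expr0n expr1n add0r sqrtr1. Qed.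

Lemma normc_Im_le x : `|complex.Im x|%:C <= `|x|.
Proof.
have := normc_ge_Re (x * 'i%C); rewrite ReiNIm normrN => /le_trans; apply.
by rewrite normrM normc_i mulr1.
Qed.

Lemma normc_le_ReIm x : `|x| <= (`|complex.Re x| + `|complex.Im x|)%:C.
Proof.
rewrite {1}[x]complexE rmorphD /=; apply: le_trans (ler_normD _ _) _.
by rewrite normrM normc_i mul1r !normc_def /= !expr0n /= !addr0 !sqrtr_sqr.
Qed.

Lemma le_limC (a x : R[i]) :
  (forall e : R, 0 < e -> exists2 y, y <= a & `|x - y| <= e%:C) -> x <= a.
Proof.
move=> h; rewrite -subr_ge0 lecE /=.
have hI : complex.Im (a - x) = 0.
  apply/eqP; rewrite -normr_le0; apply/ler_addgt0Pl => e e0; rewrite addr0.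
  have [y ya xy] := h e e0.
  have -> : complex.Im (a - x) = - complex.Im (x - y).
    move: ya; rewrite -subr_ge0 lecE /= => /andP[/eqP + _].
    by case: (a) (x) (y) => [? ?] [? ?] [? ?] /= /eqP; rewrite subr_eq0 => /eqP->; rewrite opprB.
  by rewrite normrN -lecR; apply: le_trans (normc_Im_le _) xy.
rewrite hI eqxx /=; apply/ler_addgt0Pl => e e0.
have [y ya xy] := h e e0.
have h1 : `|complex.Re (x - y)| <= e by rewrite -lecR; apply: le_trans (normc_Re_le _) xy.
move: ya; rewrite -subr_ge0 lecE /= => /andP[_].
move: h1; rewrite ler_norml => /andP[_].
case: (a) (x) (y) => [? ?] [? ?] [? ?] /= h1 h2.
by rewrite -lerBlDl sub0r lerNl opprB (le_trans _ h1)// lerD2l lerN2 -subr_ge0.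
Qed.

Lemma complex_complete (F : set_system R[i]) :
  ProperFilter F -> cauchy F -> cvg F.
Proof.
move=> FF Fc; have Fx : cauchy_ex F by apply/cauchyP.
have reC : cauchy ((fun x : R[i] => complex.Re x) @ F).
  apply/cauchy_exP => e e0.
  have /(_ e%:C) := Fx.
  rewrite ltcR => /(_ e0)[x hx]; exists (complex.Re x).
  rewrite /fmap /= /preimage.
  apply: filterS hx => y; rewrite /ball /= -ltcR => xy.
  by apply: le_lt_trans xy; move: (normc_Re_le (x - y)); rewrite ReB.
have imC : cauchy ((fun x : R[i] => complex.Im x) @ F).
  apply/cauchy_exP => e e0.
  have /(_ e%:C) := Fx.
  rewrite ltcR => /(_ e0)[x hx]; exists (complex.Im x).
  rewrite /fmap /= /preimage.
  apply: filterS hx => y; rewrite /ball /= -ltcR => xy.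
  by apply: le_lt_trans xy; move: (normc_Im_le (x - y)); rewrite ImB.
have /cauchy_cvg /cvg_ex[a ha] := reC.
have /cauchy_cvg /cvg_ex[b hb] := imC.
apply/cvg_ex; exists (a +i* b : R[i]); apply/cvgrPdist_lt => e e0.
have eE : e = (complex.Re e)%:C by rewrite RRe_real// gtr0_real.
have e0' : 0 < complex.Re e / 2 by rewrite divr_gt0// -ltcR -eE.
near=> z.
apply: le_lt_trans (normc_le_ReIm _) _; rewrite eE ltcR [ltRHS]splitr ltrD//.
- suff : `|a - complex.Re z| < complex.Re e / 2 by case: (z).
  by near: z; move/cvgrPdist_lt: ha; apply.
- suff : `|b - complex.Im z| < complex.Re e / 2 by case: (z).
  by near: z; move/cvgrPdist_lt: hb; apply.
Unshelve. all: by end_near. Qed.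

HB.instance Definition _ := Uniform_isComplete.Build R[i] complex_complete.

Definition cdot (x y : R[i]) : R[i] := x * Num.conj y.

Let cdot_bilinear : bilinear_for *%R (Num.conj \; *%R) cdot.
Proof.
split=> [u' a x y|u a x y]; rewrite /cdot /=.
  by rewrite mulrDl -mulrA.
by rewrite rmorphD rmorphM /= mulrDr mulrCA.
Qed.

HB.instance Definition _ := bilinear_isBilinear.Build _ _ _ _ _ _ cdot cdot_bilinear.

Let cdot_herm x y : cdot x y = (-1) ^+ false * Num.conj (cdot y x).
Proof. by rewrite /cdot expr0 mul1r rmorphM /= conjCK mulrC. Qed.

HB.instance Definition _ :=
  isHermitianSesquilinear.Build _ _ false (@Num.conj R[i]) cdot cdot_herm.

Let cdot_gt0 (x : R[i]) : x != 0 -> 0 < cdot x x.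
Proof. by move=> x0; rewrite /cdot -normCK exprn_gt0// normr_gt0. Qed.

HB.instance Definition _ := isDotProduct.Build _ _ cdot cdot_gt0.

Let cdot_norm (x : R[i]) : cdot x x = `|x| ^+ 2.
Proof. by rewrite normCK. Qed.

HB.instance Definition _ :=
  CompleteNormedModule_isHilbert.Build R R[i] cdot_norm.

End Complex.

Record csubspace (R : realType) (H : hilbertType R) := CSubspace {
  cs_set : set H ;
  cs0 : cs_set 0 ;
  csP : forall (a : R[i]) (x y : H), cs_set x -> cs_set y -> cs_set (a *: x + y) ;
  cs_closed : closed cs_set
}.

Section Subspace.
Variables (R : realType) (H : hilbertType R) (S : csubspace H).

Definition cs_mem : {pred H} := mem (cs_set S).

Record subsp := Subsp { subsp_val : H ; _ : subsp_val \in cs_mem }.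

HB.instance Definition _ := [isSub of subsp for subsp_val].
HB.instance Definition _ := [Choice of subsp by <:].

Let cs_mem_submod : submod_closed cs_mem.
Proof.
split; first by apply: mem_set; exact: cs0.
by move=> a x y xS yS; apply: mem_set; apply: csP; exact: set_mem.
Qed.

HB.instance Definition _ := GRing.isSubmodClosed.Build _ _ cs_mem cs_mem_submod.
HB.instance Definition _ := [SubChoice_isSubLmodule of subsp by <:].

Definition subsp_norm (x : subsp) : R[i] := `|val x|.

Let subsp_normD x y : subsp_norm (x + y) <= subsp_norm x + subsp_norm y.
Proof. by rewrite /subsp_norm raddfD; exact: ler_normD. Qed.

Let subsp_normZ (a : R[i]) x : subsp_norm (a *: x) = `|a| * subsp_norm x.
Proof. by rewrite /subsp_norm linearZ normrZ. Qed.

Let subsp_norm0 x : subsp_norm x = 0 -> x = 0.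
Proof. by move=> /normr0_eq0 x0; apply: val_inj; rewrite raddf0. Qed.

HB.instance Definition _ := Lmodule_isNormed.Build R[i] subsp
  subsp_normD subsp_normZ subsp_norm0.

Let subsp_complete (F : set_system subsp) :
  ProperFilter F -> cauchy F -> cvg F.
Proof.
move=> FF Fc; have Fx : cauchy_ex F by apply/cauchyP.
have vC : cauchy ((fun x : subsp => val x) @ F).
  apply/cauchy_exP => e e0.
  have [x hx] := Fx _ e0; exists (val x).
  rewrite /fmap /= /preimage.
  apply: filterS hx => y; rewrite -!ball_normE /= => xy.
  have <- : `|x - y| = `|val x - val y| by rewrite -raddfB.
  exact: xy.
have /cauchy_cvg /cvg_ex[a ha] := vC.
have Sa : cs_set S a.
  apply: (@closed_cvg _ _ _ FF (fun x => val x) _ (@cs_closed _ _ S) _ _ ha).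
  by apply: nearW => x; exact: set_mem (valP x).
apply/cvg_ex; exists (Subsp (mem_set Sa)); apply/cvgrPdist_lt => e e0.
near=> z.
have: `|a - val z| < e by near: z; move/cvgrPdist_lt: ha; apply.
by [].
Unshelve. all: by end_near. Qed.

HB.instance Definition _ := Uniform_isComplete.Build subsp subsp_complete.

Definition subsp_dot (x y : subsp) : R[i] := hdot (val x) (val y).

Let subsp_dot_bilinear : bilinear_for *%R (Num.conj \; *%R) subsp_dot.
Proof.
split=> [u' a x y|u a x y]; rewrite /subsp_dot /=.
  by rewrite linearPl.
by rewrite linearPr.
Qed.

HB.instance Definition _ :=
  bilinear_isBilinear.Build _ _ _ _ _ _ subsp_dot subsp_dot_bilinear.

Let subsp_dot_herm x y :
  subsp_dot x y = (-1) ^+ false * Num.conj (subsp_dot y x).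
Proof. exact: hermC. Qed.

HB.instance Definition _ := isHermitianSesquilinear.Build
  _ _ false (@Num.conj R[i]) subsp_dot subsp_dot_herm.

Let subsp_dot_gt0 (x : subsp) : x != 0 -> 0 < subsp_dot x x.
Proof. by move=> x0; rewrite neq0_dnorm_gt0. Qed.

HB.instance Definition _ := isDotProduct.Build _ _ subsp_dot subsp_dot_gt0.

Let subsp_dot_norm (x : subsp) : subsp_dot x x = `|x| ^+ 2.
Proof. exact: hdot_norm. Qed.

HB.instance Definition _ :=
  CompleteNormedModule_isHilbert.Build R subsp subsp_dot_norm.

End Subspace.

Section DotForm.
Variables (C : numClosedFieldType) (U : lmodType C) (form : {dot U for @Num.conj C}).
Implicit Types u v : U.

Lemma dot_CauchySchwarz u v : `|form u v| ^+ 2 <= form u u * form v v.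
Proof.
have [->|v0] := eqVneq v 0; first by rewrite linear0r normr0 expr0n /= linear0r mulr0.
have vv0 : form v v != 0 by rewrite dnorm_eq0.
have vv : 0 < form v v by rewrite dnorm_gt0.
pose a := form u v / form v v.
have ow : form (u - a *: v) v = 0 by rewrite linearBl linearZl_LR /= divfK// subrr.
have := dnorm_ge0 form (u - a *: v).
have -> : form (u - a *: v) (u - a *: v) = form u u - a * form v u.
  by rewrite [LHS]linearBr [X in _ - X]linearZr_LR /= ow mulr0 subr0 linearBl linearZl_LR.
have -> : form v u = Num.conj (form u v) by rewrite [LHS]hermC expr0 mul1r.
by rewrite subr_ge0 /a mulrAC -normCK ler_pdivrMr.
Qed.

Lemma dot_CauchySchwarz_sqrt u v :
  `|form u v| <= sqrtC (form u u) * sqrtC (form v v).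
Proof.
rewrite -(@ler_pXn2r _ 2)// ?nnegrE ?mulr_ge0 ?sqrt_dnorm_ge0//.
by rewrite exprMn !sqrtCK dot_CauchySchwarz.
Qed.

Lemma dot_triangle u v : sqrtC (form (u + v) (u + v)) <=
  sqrtC (form u u) + sqrtC (form v v).
Proof.
have s0 w : 0 <= sqrtC (form w w) by rewrite sqrt_dnorm_ge0.
rewrite -(@ler_pXn2r _ 2)// ?nnegrE ?addr_ge0//.
rewrite sqrrD !sqrtCK dnormD /= [leRHS]addrAC lerD2l.
apply: (le_trans (real_ler_norm _)).
  by rewrite CrealE rmorphD /= conjCK addrC.
apply: le_trans (ler_normD _ _) _.
by rewrite norm_conjC -mulr2n lerMn2r /= dot_CauchySchwarz_sqrt.
Qed.

End DotForm.

Section ClosedSpan.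
Variables (R : realType) (H : hilbertType R).

Lemma hdot_CauchySchwarz (x y : H) : `|hdot x y| <= `|x| * `|y|.
Proof.
by have := dot_CauchySchwarz_sqrt hdot x y; rewrite !hdot_norm !sqrCK.
Qed.

(* Finite linear combinations of elements of A, each given by its list of
   (coefficient, vector) pairs. *)
Definition lspan (A : set H) : set H :=
  [set v | exists2 s : seq (R[i] * H), (forall c, c \in s -> A c.2) &
             v = \sum_(c <- s) c.1 *: c.2].

Lemma closure_lspan0 A : closure (lspan A) 0.
Proof. by apply: subset_closure; exists [::]; rewrite ?big_nil. Qed.

Lemma closure_lspanP A (a : R[i]) (x y : H) :
  closure (lspan A) x -> closure (lspan A) y ->
  closure (lspan A) (a *: x + y).
Proof.
move=> xA yA B Bxy.
have : (fun u : H * H => a *: u.1 + u.2) @ (x, y) --> a *: x + y.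
  by apply: cvgD; [apply: cvgZr; exact: cvg_fst|exact: cvg_snd].
move=> /(_ _ Bxy)[[U V]/= [Ux Vy] UV].
have [u [[s sA ->] Uu]] := xA _ Ux.
have [v [[t tA ->] Vv]] := yA _ Vy.
exists (a *: (\sum_(c <- s) c.1 *: c.2) + \sum_(c <- t) c.1 *: c.2).
split; last by apply: (UV (_, _)).
exists ([seq (a * c.1, c.2) | c <- s] ++ t).
  move=> c; rewrite mem_cat => /orP[/mapP[d ds ->]/=|]; [exact: sA|exact: tA].
rewrite big_cat big_map /= scaler_sumr; congr (_ + _).
by apply: eq_bigr => c _; rewrite scalerA.
Qed.

Definition cspan (A : set H) : csubspace H :=
  CSubspace (closure_lspan0 A) (@closure_lspanP A) (@closed_closure _ (lspan A)).

Definition orth (A : set H) : set H :=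
  [set x | forall y, A y -> hdot x y = 0].

Lemma orth0 A : orth A 0.
Proof. by move=> y _; rewrite linear0l. Qed.

Lemma orth_lin A (a : R[i]) (x y : H) :
  orth A x -> orth A y -> orth A (a *: x + y).
Proof. by move=> xA yA z Az; rewrite linearPl /= xA// yA// mulr0 addr0. Qed.

Lemma orth_closed A : closed (orth A).
Proof.
move=> x xA y Ay; apply/eqP; rewrite -normr_le0.
apply: le_limC => e e0.
exists 0 => //; rewrite subr0 normr_id.
have c0 : 0 < e%:C / (`|y| + 1) by rewrite divr_gt0 ?ltcR// ltr_wpDl.
have [z [Az xz]] := xA _ (nbhsx_ballx x _ c0).
have -> : hdot x y = hdot (x - z) y by rewrite linearBl /= Az// subr0.
apply: le_trans (hdot_CauchySchwarz _ _) _.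
move: xz; rewrite -ball_normE /= => /ltW xz.
apply: le_trans (_ : e%:C / (`|y| + 1) * `|y| <= _); first exact: ler_wpM2r.
by rewrite mulrAC ler_pdivrMr ?ltr_wpDl// ler_wpM2l ?lecR ?ltW// ltrDl.
Qed.

Definition ocompl (A : set H) : csubspace H :=
  @CSubspace R H (orth A) (orth0 (A := A)) (@orth_lin A) (@orth_closed A).

End ClosedSpan.

#[global] Existing Instance summability.totally_filter.

Section UnorderedSum.
Variables (R : realType) (I : choiceType).
Implicit Types (c : I -> R[i]) (J : {fset I}).

Lemma partial_sumE c J : summability.partial_sum c J = \sum_(i <- J) c i.
Proof. by rewrite big_seq_fsetE. Qed.

Lemma big_fset_split c (J K : {fset I}) : (J `<=` K)%fset ->
  \sum_(i <- K) c i = \sum_(i <- J) c i + \sum_(i <- (K `\` J)%fset) c i.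
Proof.
move=> JK; rewrite (big_fsetID _ (fun i => i \in J)) /=.
congr (_ + _); apply: eq_fbigl => i; rewrite !inE /= ?andbT.
  by apply/andP/idP => [[]//|iJ]; split=> //; exact: (fsubsetP JK).
by rewrite andbC.
Qed.

Lemma ler_sum_fset c (J K : {fset I}) : (forall i, 0 <= c i) ->
  (J `<=` K)%fset -> \sum_(i <- J) c i <= \sum_(i <- K) c i.
Proof. by move=> c0 JK; rewrite (big_fset_split _ JK) lerDl sumr_ge0. Qed.

Lemma abs_summable_cvg c :
  (exists M, forall J, \sum_(i <- J) `|c i| <= M) ->
  cvg (summability.partial_sum c @ summability.totally).
Proof.
move=> [M hM]; apply: cauchy_cvg; apply/cauchy_exP => e e0.
pose q J := complex.Re (\sum_(i <- J) `|c i|).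
have qE J : \sum_(i <- J) `|c i| = (q J)%:C.
  by rewrite /q RRe_real// realE sumr_ge0.
have qs : has_sup (range q).
  split; first by exists (q fset0); exists fset0.
  exists (complex.Re M) => _ [J _ <-].
  by have := hM J; rewrite lecE => /andP[].
have eE : e = (complex.Re e)%:C by rewrite RRe_real// gtr0_real.
have e0' : 0 < complex.Re e by rewrite -ltcR -eE.
have [_ [J0 _ <-] hJ0] := sup_adherent e0' qs.
exists (\sum_(i <- J0) c i); exists J0 => // J /= J0J.
rewrite /preimage /= -ball_normE /= partial_sumE (big_fset_split _ J0J).
rewrite opprD addrA subrr sub0r normrN.
apply: le_lt_trans (ler_norm_sum _ _ _) _.
have : q J <= sup (range q) by apply: sup_upper_bound => //; exists J.
have -> : \sum_(i <- (J `\` J0)%fset) `|c i| = (q J - q J0)%:C.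
  rewrite rmorphB /= -!qE (big_fset_split _ J0J).
  by rewrite addrAC subrr add0r.
rewrite eE ltcR => qJ; rewrite ltrBlDr.
by apply: le_lt_trans qJ _; rewrite -ltrBlDl.
Qed.

Lemma sum_le c M : cvg (summability.partial_sum c @ summability.totally) ->
  (forall J, \sum_(i <- J) c i <= M) -> summability.sum c <= M.
Proof.
move=> /cvg_ex[l hl] hM; have -> : summability.sum c = l by exact: cvg_lim hl.
apply: le_limC => e e0.
have /(_ _) := (cvgrPdist_le _ _).1 hl e%:C.
rewrite ltcR => /(_ e0)[J _ /(_ J)] /= h.
exists (\sum_(i <- J) c i) => //; rewrite -partial_sumE; apply: h.
exact: fsubset_refl.
Qed.

Lemma sum_ge c (J : {fset I}) : (forall i, 0 <= c i) ->
  cvg (summability.partial_sum c @ summability.totally) ->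
  \sum_(i <- J) c i <= summability.sum c.
Proof.
move=> c0 /cvg_ex[l hl]; have -> : summability.sum c = l by exact: cvg_lim hl.
rewrite -lerN2; apply: le_limC => e e0.
have /(_ _) := (cvgrPdist_le _ _).1 hl e%:C.
rewrite ltcR => /(_ e0)[K _ /(_ (J `|` K)%fset)] /= h.
exists (- \sum_(i <- (J `|` K)%fset) c i).
  by rewrite lerN2 ler_sum_fset ?fsubsetUl.
rewrite -partial_sumE opprK addrC distrC; apply: h.
exact: fsubsetUr.
Qed.

End UnorderedSum.

Section L2.
Variables (R : realType) (I : choiceType) (H : hilbertType R).

(* Sums over an arbitrary index type are unordered: limits of the net of finite
   partial sums. `l2 I H` is the Hilbert space of square-summable families
   I -> H, i.e. the Hilbert direct sum of copies of H. *)
Definition square_summable (f : I -> H) : Prop :=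
  exists M : R[i], forall J : {fset I}, \sum_(i <- J) `|f i| ^+ 2 <= M.

Definition l2_mem : {pred (I -> H)} := fun f => `[< square_summable f >].

Record l2 := L2 { l2_val :> I -> H ; _ : l2_val \in l2_mem }.

HB.instance Definition _ := [isSub of l2 for l2_val].
HB.instance Definition _ := [Choice of l2 by <:].

Lemma normr_sqrD (x y : H) : `|x + y| ^+ 2 <= 2 * (`|x| ^+ 2 + `|y| ^+ 2).
Proof.
apply: (@le_trans _ _ ((`|x| + `|y|) ^+ 2)).
  by rewrite lerXn2r ?nnegrE// ler_normD.
rewrite -subr_ge0.
have -> : 2 * (`|x| ^+ 2 + `|y| ^+ 2) - (`|x| + `|y|) ^+ 2 = (`|x| - `|y|) ^+ 2.
  by rewrite !expr2 !mulrDl !mulrDr !mulrN !mulNr mul1r; ring.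
by rewrite real_exprn_even_ge0// rpredB ?normr_real.
Qed.

Let l2_mem_submod : submod_closed l2_mem.
Proof.
split.
  apply/asboolP; exists 0 => J; rewrite big1// => i _.
  by rewrite [(0 : I -> H) i]/(0 : H) normr0 expr0n.
move=> a f g /asboolP[M hM] /asboolP[N hN]; apply/asboolP.
exists (2 * (`|a| ^+ 2 * M + N)) => J.
apply: le_trans (_ : \sum_(i <- J) 2 * (`|a| ^+ 2 * `|f i| ^+ 2 + `|g i| ^+ 2) <= _).
  apply: ler_sum => i _; apply: le_trans (normr_sqrD _ _) _.
  by rewrite -[(a *: f) i]/(a *: f i) normrZ exprMn.
rewrite -mulr_sumr ler_wpM2l// big_split /= -mulr_sumr lerD// ler_wpM2l//.
Qed.

HB.instance Definition _ := GRing.isSubmodClosed.Build _ _ l2_mem l2_mem_submod.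
HB.instance Definition _ := [SubChoice_isSubLmodule of l2 by <:].

Definition l2dot (f g : l2) : R[i] := summability.sum (fun i => hdot (f i) (g i)).

Lemma l2P (f : l2) : square_summable f.
Proof. by have := valP f => /asboolP. Qed.

Lemma l2dot_cvg (f g : l2) :
  cvg (summability.partial_sum (fun i => hdot (f i) (g i) : R[i]) @ summability.totally).
Proof.
apply: abs_summable_cvg; have [M hM] := l2P f; have [N hN] := l2P g.
exists (M + N) => J; apply: le_trans (lerD (hM J) (hN J)).
rewrite -big_split /=; apply: ler_sum => i _.
apply: le_trans (hdot_CauchySchwarz _ _) _.
have x0 : 0 <= `|f i| by []. have y0 : 0 <= `|g i| by [].
rewrite -subr_ge0.
have -> : `|f i| ^+ 2 + `|g i| ^+ 2 - `|f i| * `|g i| =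
  (`|f i| - `|g i|) ^+ 2 + `|f i| * `|g i| by ring.
apply: addr_ge0; last exact: mulr_ge0.
by rewrite real_exprn_even_ge0// rpredB ?normr_real.
Qed.

Let l2dot_lim (f g : l2) : summability.partial_sum (fun i => hdot (f i) (g i) : R[i])
  @ summability.totally --> (l2dot f g : R[i]).
Proof. exact: l2dot_cvg. Qed.

Let l2dot_linl u' : GRing.linear_for *%R (fun f => l2dot f u').
Proof.
move=> a x y; apply: cvg_lim; first exact: norm_hausdorff.
have -> : summability.partial_sum (fun i => hdot ((a *: x + y) i) (u' i) : R[i]) =
   (fun J => a * summability.partial_sum (fun i => hdot (x i) (u' i) : R[i]) J +
     summability.partial_sum (fun i => hdot (y i) (u' i) : R[i]) J).
  apply/funext => J; rewrite !partial_sumE mulr_sumr -big_split /=.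
  by apply: eq_bigr => i _; rewrite -linearPl.
by apply: cvgD; [apply: cvgMl_tmp|]; exact: l2dot_lim.
Qed.

Let l2dot_herm x y : l2dot x y = (-1) ^+ false * Num.conj (l2dot y x).
Proof.
rewrite expr0 mul1r; apply: cvg_lim; first exact: norm_hausdorff.
have -> : summability.partial_sum (fun i => hdot (x i) (y i) : R[i]) =
   (fun J => Num.conj (summability.partial_sum (fun i => hdot (y i) (x i) : R[i]) J)).
  apply/funext => J; rewrite !partial_sumE rmorph_sum /=.
  by apply: eq_bigr => i _; rewrite [LHS]hermC expr0 mul1r.
apply/cvgrPdist_le => e e0.
have h := (cvgrPdist_le _ _).1 (@l2dot_lim y x) e e0.
near=> J; rewrite -rmorphB norm_conjC; near: J; exact: h.
Unshelve. all: by end_near.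
Qed.

Let l2dot_bilinear : bilinear_for *%R (Num.conj \; *%R) l2dot.
Proof.
split=> [|u a x y /=]; first exact: l2dot_linl.
rewrite l2dot_herm [l2dot u x]l2dot_herm [l2dot u y]l2dot_herm !expr0 !mul1r.
by rewrite l2dot_linl rmorphD rmorphM.
Qed.

HB.instance Definition _ :=
  bilinear_isBilinear.Build _ _ _ _ _ _ l2dot l2dot_bilinear.
HB.instance Definition _ := isHermitianSesquilinear.Build
  _ _ false (@Num.conj R[i]) l2dot l2dot_herm.

Lemma l2dot_ge (f : l2) (J : {fset I}) : \sum_(i <- J) `|f i| ^+ 2 <= l2dot f f.
Proof.
under eq_bigr do rewrite -hdot_norm.
apply: sum_ge; last exact: l2dot_cvg.
by move=> i; rewrite hdot_norm exprn_ge0.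
Qed.

Lemma l2dot_le (f : l2) M : (forall J : {fset I}, \sum_(i <- J) `|f i| ^+ 2 <= M) ->
  l2dot f f <= M.
Proof.
move=> hM; apply: sum_le; first exact: l2dot_cvg.
by move=> J; under eq_bigr do rewrite hdot_norm; exact: hM.
Qed.

Let l2dot_gt0 (f : l2) : f != 0 -> 0 < l2dot f f.
Proof.
move=> f0; have [i fi] : exists i, f i != 0.
  apply: contrapT => /forallNP h; move/negP: f0; apply; apply/eqP/val_inj.
  by apply/funext => i /=; apply/eqP/negPn/negP; exact: h.
have := l2dot_ge f [fset i]%fset; rewrite big_seq_fset1.
by apply: lt_le_trans; rewrite exprn_gt0// normr_gt0.
Qed.

HB.instance Definition _ := isDotProduct.Build _ _ l2dot l2dot_gt0.

Definition l2_norm (f : l2) : R[i] := sqrtC (l2dot f f).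

Let l2_normD f g : l2_norm (f + g) <= l2_norm f + l2_norm g.
Proof. exact: (dot_triangle l2dot). Qed.

Let l2_normZ (a : R[i]) f : l2_norm (a *: f) = `|a| * l2_norm f.
Proof.
rewrite /l2_norm (dnormZ l2dot) sqrtCM ?nnegrE ?exprn_ge0//.
  by rewrite sqrCK.
Qed.

Let l2_norm0 f : l2_norm f = 0 -> f = 0.
Proof. by move=> /eqP; rewrite sqrt_dnorm_eq0 => /eqP. Qed.

HB.instance Definition _ := Lmodule_isNormed.Build R[i] l2
  l2_normD l2_normZ l2_norm0.

Let l2dot_norm (f : l2) : l2dot f f = `|f| ^+ 2.
Proof. by rewrite [X in X ^+ 2]/(l2_norm f) sqrtCK. Qed.

Let l2_coord_le (f : l2) i : `|f i| <= `|f|.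
Proof.
rewrite -(@ler_pXn2r _ 2)// ?nnegrE// -l2dot_norm.
by have := l2dot_ge f [fset i]%fset; rewrite big_seq_fset1.
Qed.

Let l2_complete (F : set_system l2) : ProperFilter F -> cauchy F -> cvg F.
Proof.
move=> FF Fc; have Fx : cauchy_ex F by apply/cauchyP.
have Fb : cauchy_ball F by apply/cauchy_ballP.
have coord i : exists a : H, (fun f : l2 => f i) @ F --> a.
  apply: (cvg_ex _).1; apply: cauchy_cvg; apply/cauchy_exP => e e0.
  have [x hx] := Fx _ e0; exists (x i).
  rewrite /fmap /= /preimage.
  apply: filterS hx => y; rewrite -!ball_normE /= => xy.
  by apply: le_lt_trans xy; exact: (l2_coord_le (x - y)).
have /choice[f hf] : forall i, exists a : H, (fun f : l2 => f i) @ F --> a by exact: coord.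
have small (s : seq I) d : 0 < d ->
    \forall y \near F, \sum_(i <- s) `|l2_val y i - f i| ^+ 2 <= d.
  elim: s d => [|i s IHs] d d0; first by apply: nearW => y; rewrite big_nil ltW.
  have d2 : 0 < d / 2 by rewrite divr_gt0.
  have sd2 : 0 < sqrtC (d / 2) by rewrite sqrtC_gt0.
  move/cvgrPdist_le: (hf i) => /(_ _ sd2) hi; have hs := IHs _ d2.
  near=> y; have hi' : `|f i - y i| <= sqrtC (d / 2) by near: y.
  have hs' : \sum_(i <- s) `|y i - f i| ^+ 2 <= d / 2 by near: y.
  rewrite big_cons [leRHS]splitr lerD// distrC -[leRHS]sqrtCK.
  by rewrite lerXn2r ?nnegrE// ltW.
have key e : 0 < e -> \forall x \near F, forall J : {fset I},
    \sum_(i <- J) `|l2_val x i - f i| ^+ 2 <= 4 * e ^+ 2.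
  move=> e0; have /nearP_dep h := Fb _ e0.
  near=> x => J; have hx : \forall y \near F, ball x e y by near: x.
  have [y [xy yf]] := @filter_ex _ F _ _ (filterI hx (small J _ (exprn_gt0 2 e0))).
  apply: le_trans (_ : \sum_(i <- J) 2 * (`|x i - y i| ^+ 2 + `|y i - f i| ^+ 2) <= _).
    apply: ler_sum => i _; apply: le_trans (normr_sqrD _ _).
    by rewrite addrA subrK.
  have -> : 4 * e ^+ 2 = 2 * (e ^+ 2 + e ^+ 2) by ring.
  rewrite -mulr_sumr ler_wpM2l// big_split lerD//.
  have := l2dot_ge (x - y) J; move=> /le_trans; apply.
  have {}xy : `|x - y| < e by move: xy; rewrite -ball_normE.
  by rewrite l2dot_norm lerXn2r ?nnegrE ?(ltW e0)// ltW.
have sf : square_summable f.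
  have [x hx] := @filter_ex _ F _ _ (key 1 ltr01); have [M hM] := l2P x.
  exists (2 * (4 * 1 ^+ 2 + M)) => J.
  apply: le_trans (_ : \sum_(i <- J) 2 * (`|x i - f i| ^+ 2 + `|x i| ^+ 2) <= _).
    apply: ler_sum => i _; rewrite distrC; apply: le_trans (normr_sqrD _ _).
    by rewrite subrK.
  by rewrite -mulr_sumr ler_wpM2l// big_split lerD.
have mf : f \in l2_mem by apply/asboolP.
apply/cvg_ex; exists (L2 mf); apply/cvgrPdist_le => e e0.
have := key (e / 2); rewrite divr_gt0// => /(_ isT) hk.
near=> x.
have hx : forall J : {fset I}, \sum_(i <- J) `|l2_val x i - f i| ^+ 2 <= 4 * (e / 2) ^+ 2.
  by near: x.
rewrite distrC.
rewrite -(@ler_pXn2r _ 2)// ?nnegrE ?(ltW e0)// -l2dot_norm.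
apply: l2dot_le => J; apply: le_trans (hx J) _.
by rewrite expr_div_n -natrX mulrC divfK// pnatr_eq0.
Unshelve. all: by end_near. Qed.

HB.instance Definition _ := Uniform_isComplete.Build l2 l2_complete.
HB.instance Definition _ :=
  CompleteNormedModule_isHilbert.Build R l2 l2dot_norm.

End L2.

Section Basis.
Variables (R : realType) (I : choiceType).

Definition delta_fun (i j : I) : R[i] := (j == i)%:R.

Lemma delta_l2 i : delta_fun i \in @l2_mem R I R[i].
Proof.
apply/asboolP; exists 1 => J.
apply: le_trans (_ : \sum_(j <- (i |` J)%fset) `|delta_fun i j| ^+ 2 <= _).
  by apply: ler_sum_fset; rewrite ?fsubsetUr// => j; rewrite exprn_ge0.
rewrite (big_fsetD1 i) ?fset1U1//= big_seq big1 => [|j].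
  by rewrite /delta_fun eqxx normr1 expr1n addr0.
by rewrite !inE /delta_fun => /andP[/negbTE -> _]; rewrite normr0 expr0n.
Qed.

Definition l2_basis (i : I) : l2 I R[i] := L2 (delta_l2 i).

Variables (N : csubspace (l2 I R[i])) (K : hilbertType R).

Lemma tens_l2 (x : l2 I R[i]) (d : K) :
  (fun i => (x i : R[i]) *: d) \in @l2_mem R I K.
Proof.
have [M hM] := l2P x; apply/asboolP; exists (M * `|d| ^+ 2) => J.
under eq_bigr do rewrite normrZ exprMn.
by rewrite -mulr_suml ler_wpM2r// exprn_ge0.
Qed.

(* l2(I; K) is the Hilbert tensor product l2(I) (x) K, with (x (x) d)_i = x_i d;
   see `hdot_tens`. *)
Definition tens (x : l2 I R[i]) (d : K) : l2 I K := L2 (tens_l2 x d).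

Lemma hdot_tens (x y : l2 I R[i]) (d e : K) :
  hdot (tens x d) (tens y e) = hdot x y * hdot d e.
Proof.
apply: cvg_lim; first exact: norm_hausdorff.
have -> : summability.partial_sum (fun i => hdot (tens x d i) (tens y e i) : R[i]) =
   (fun J => summability.partial_sum (fun i => hdot (x i) (y i) : R[i]) J * hdot d e).
  apply/funext => J; rewrite !partial_sumE mulr_suml.
  apply: eq_bigr => i _ /=; rewrite [LHS]linearZl_LR linearZr_LR /=.
  by rewrite mulrA.
by apply: cvgMr_tmp; exact: l2dot_cvg.
Qed.

(* N (x) K for a closed subspace N of l2(I): the closed span in l2(I) (x) K of the
   elementary tensors of elements of N and K. *)
Definition htens : csubspace (l2 I K) :=
  cspan [set tens (val x) d | x in [set: subsp N] & d in [set: K]].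

Lemma etens_mem (x : subsp N) (d : K) : tens (val x) d \in cs_mem htens.
Proof.
apply/mem_set/subset_closure.
exists [:: (1, tens (val x) d)]; last by rewrite big_seq1 scale1r.
by move=> c; rewrite inE => /eqP -> /=; exists x => //; exists d.
Qed.

Definition etens (x : subsp N) (d : K) : subsp htens := Subsp (etens_mem x d).

End Basis.

Section Operators.
Variable R : realType.

Definition bounded_op (H K : hilbertType R) (A : H -> K) : Prop :=
  linear A /\ continuous A.

(* Adjoints, positive square roots, orthogonal projections and A (x) I are the
   unique objects with their defining property; `get` returns that object
   whenever it exists. Operators are plain functions, and boundedness
   (`bounded_op`) is stated separately. *)
Definition adjoint (H K : hilbertType R) (A : H -> K) : K -> H :=
  get [set B : K -> H | forall x y, hdot (A x) y = hdot x (B y)].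

Definition positive_op (H : hilbertType R) (A : H -> H) : Prop :=
  bounded_op A /\ forall x, 0 <= hdot (A x) x.

Definition op_sqrt (H : hilbertType R) (A : H -> H) : H -> H :=
  get [set S : H -> H | positive_op S /\ S \o S = A].

Definition unitary (H K : hilbertType R) (U : H -> K) : Prop :=
  [/\ linear U, forall x y, hdot (U x) (U y) = hdot x y & range U = setT].

Definition orth_proj (H : hilbertType R) (S : csubspace H) (x : H) : subsp S :=
  get [set y : subsp S | forall z : subsp S, hdot (x - val y) (val z) = 0].

Definition invariant_subspace (H : hilbertType R) (S : csubspace H) (A : H -> H) : Prop :=
  forall x, cs_set S x -> cs_set S (A x).

Definition restrict_op (H : hilbertType R) (S : csubspace H) (A : H -> H) :
  subsp S -> subsp S := fun x => insubd 0 (A (val x)).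

Definition tens_id (I : choiceType) (N : csubspace (l2 I R[i])) (K : hilbertType R)
    (A : subsp N -> subsp N) : subsp (htens N K) -> subsp (htens N K) :=
  get [set C | bounded_op C /\ forall x d, C (etens x d) = etens (A x) d].

(* The series of operators F i converges to Z in the weak operator topology. *)
Definition wot_sum (I : choiceType) (H : hilbertType R) (F : I -> H -> H) (Z : H -> H) : Prop :=
  bounded_op Z /\ forall x y : H,
    summability.partial_sum (fun i => hdot (F i x) y : R[i]) @ summability.totally
      --> (hdot (Z x) y : R[i]).

End Operators.

Arguments restrict_op {R H} S A _.

Section FreeHolomorphic.
Variables (R : realType) (n : nat).

Definition word := seq 'I_n.

(* X_w = X_{i_1} ... X_{i_k} for w = [:: i_1; ...; i_k]. *)
Definition opword (H : Type) (X : 'I_n -> H -> H) (w : word) : H -> H :=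
  foldr (fun i A => X i \o A) id w.

Record pos_regular (a : word -> R) : Prop := {
  pos_regular_limsup : (limn_esup (fun k : nat =>
    ((\sum_(w : k.-tuple 'I_n) `|a w| ^+ 2) `^ (2 * k)%:R^-1)%:E) < +oo)%E ;
  pos_regular_ge0 : forall w, 0 <= a w ;
  pos_regular_nil : a [::] = 0 ;
  pos_regular_gen : forall i, 0 < a [:: i]
}.

Variable a : word -> R.

(* Summing over all words is the same as summing over |w| >= 1, since
   a_{g_0} = 0 (`pos_regular_nil`). *)
Definition Phi_term (H : hilbertType R) (X : 'I_n -> H -> H) (Y : H -> H) (w : word) :
    H -> H :=
  fun x => (a w)%:C *: opword X w (Y (adjoint (opword X w) x)).

Definition wot_convergent (H : hilbertType R) (X : 'I_n -> H -> H) : Prop :=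
  exists Z, wot_sum (Phi_term X id) Z.

Definition Phi (H : hilbertType R) (X : 'I_n -> H -> H) (Y : H -> H) : H -> H :=
  get [set Z | wot_sum (Phi_term X Y) Z].

(* (id - Phi_X)^s (I). *)
Definition defect (H : hilbertType R) (X : 'I_n -> H -> H) (s : nat) : H -> H :=
  iter s (fun Y x => Y x - Phi X Y x) id.

Definition nc_domain (m : nat) (H : hilbertType R) (X : 'I_n -> H -> H) : Prop :=
  [/\ forall i, bounded_op (X i), wot_convergent X &
      forall s, (1 <= s <= m)%N -> positive_op (defect X s)].

Definition pure_tuple (H : hilbertType R) (X : 'I_n -> H -> H) : Prop :=
  forall x : H, (fun k : nat => iter k (Phi X) id x) @ \oo --> (0 : H).

(* Noncommutative polynomials, as finitely supported families of coefficients. *)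
Definition ncpoly := {fsfun word -> R[i] with 0}.

Definition nceval (H : hilbertType R) (X : 'I_n -> H -> H) (p : ncpoly) : H -> H :=
  fun x => \sum_(w <- finsupp p) p w *: opword X w x.

Definition nc_variety (m : nat) (P : set ncpoly) (H : hilbertType R) (X : 'I_n -> H -> H) : Prop :=
  nc_domain m X /\ forall p, P p -> forall x, nceval X p x = 0.

(* The factorizations of w into j nonempty words; see `mem_factorizations`. *)
Fixpoint factorizations (j : nat) (w : word) : seq (seq word) :=
  if j is j'.+1 then
    [seq take k w :: v | k <- iota 1 (size w), v <- factorizations j' (drop k w)]
  else if w is [::] then [:: [::]] else [::].

Lemma mem_factorizations j w v : (v \in factorizations j w) =
  [&& size v == j, flatten v == w & all (fun u : word => u != [::]) v].
Proof.
elim: j w v => [|j IHj] w v /=.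
  by case: w v => [|i w] [|u v]//=; rewrite ?inE.
apply/allpairsPdep/idP => /= [[k [v' [+ + ->]]]|].
  rewrite mem_iota IHj /= => /andP[k0 kw] /and3P[/eqP -> /eqP -> ->].
  rewrite eqxx cat_take_drop eqxx andbT /= -size_eq0 size_take.
  by rewrite -lt0n; case: ifP => // _; move: kw; rewrite ltnS; exact: leq_trans.
case: v => [|u v]//= /and3P[sv /eqP <- /andP[u0 av]].
exists (size u), v; rewrite take_size_cat// drop_size_cat// IHj eqxx av.
rewrite -eqSS sv mem_iota size_cat; split=> //.
by rewrite -size_eq0 -lt0n in u0; rewrite u0 add1n ltnS leq_addr.
Qed.

Lemma factorizations_uniq j w : uniq (factorizations j w).
Proof.
elim: j w => [|j IHj] w /=; first by case: w.
apply: allpairs_uniq_dep => [|k _|]; [exact: iota_uniq|exact: IHj|].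
move=> [k v] [l u] /allpairsPdep[k' [v' [kw _ [-> _]]]].
move=> /allpairsPdep[l' [u' [lw _ [-> _]]]] /= [].
move=> e <-; congr existT; move/(congr1 size): e.
move: kw lw; rewrite !mem_iota !size_take; do 2 case: ifP; lia.
Qed.

Definition bcoef (m : nat) (w : word) : R :=
  if w is [::] then 1 else
  \sum_(1 <= j < (size w).+1) \sum_(v <- factorizations j w)
    (\prod_(u <- v) a u) * 'C(j + m - 1, m - 1)%:R.

(* The full Fock space: the basis vector e_w is `l2_basis R w`. *)
Definition fock : hilbertType R := l2 word R[i].

(* W_i is bounded when a is positive regular, as b_{g_i w} >= a_{g_i} b_w. *)
Definition wshift (m : nat) (i : 'I_n) : fock -> fock :=
  get [set A | bounded_op A /\ forall w,
    A (l2_basis R w) =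
      (Num.sqrt (bcoef m w / bcoef m (i :: w)))%:C *: l2_basis R (i :: w)].

Definition M_sub (m : nat) (P : set ncpoly) : csubspace fock :=
  cspan [set v | exists p u w, P p /\
    v = opword (wshift m) u (nceval (wshift m) p (opword (wshift m) w (l2_basis R [::])))].

Definition N_sub (m : nat) (P : set ncpoly) : csubspace fock :=
  ocompl (cs_set (M_sub m P)).

Definition universal_model (m : nat) (P : set ncpoly) (i : 'I_n) : subsp (N_sub m P) -> subsp (N_sub m P) :=
  fun x => orth_proj (N_sub m P) (wshift m i (val x)).

(* The range of the square root is a linear subspace, so its closed span is its
   closure. *)
Definition defect_space (m : nat) (H : hilbertType R) (X : 'I_n -> H -> H) : csubspace H :=
  cspan (range (op_sqrt (defect X m))).

End FreeHolomorphic.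

Arguments universal_model {R n} a m P i _.

(* Main.v *)
Require Import Defs.
From mathcomp Require Import all_boot all_order all_algebra.
From mathcomp Require Import complex finmap.
From mathcomp Require Import all_classical all_reals all_analysis.
From mathcomp Require summability.
From mathcomp Require Import ring lra zify.

Set Implicit Arguments.
Unset Strict Implicit.
Unset Printing Implicit Defensive.

Import Order.TTheory GRing.Theory Num.Theory.
Import numFieldNormedType.Exports.

Local Open Scope classical_set_scope.
Local Open Scope ring_scope.
Local Open Scope complex_scope.

(** Both directions compare [T] with the backward shifts on [l2(words) (x) D],
    the maps [W_i^* (x) 1] that send [f] to the family
    [sqrt (b_w / b_(i w)) f (i w)]. Everything is expressed through quadratic
    forms: if [Y >= 0] then [<Phi(Y) x, x>] is the sum over words of
    [a_w <Y T_w^* x, T_w^* x>] ([Phi_qform]), a sum of nonnegative numbers in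
    which summations can be exchanged freely. Composing such sums multiplies
    the coefficients as noncommutative power series ([esum_conv]), so identities
    between the maps [Phi^k] reduce to identities between [a] and
    [b = (1 - a)^-m] ([bb_rec]).

    If [T] is pure and in the variety, let [Delta = (id - Phi)^m (I)]. Purity
    lets one invert [id - Phi] [m] times by the geometric series, so that the
    sum of the [b_w <Delta T_w^* x, T_w^* x>] is [|x|^2]
    ([pure_reconstruction]). This says that the noncommutative Poisson kernel
    [V x = (sqrt (b_w) Delta^(1/2) T_w^* x)_w] is an isometry. It intertwines
    the [T_i^*] with the backward shifts, and its values lie in [N (x) D]: an
    element of [l2(words) (x) D] lies there as soon as all its slices along
    vectors of [D] lie in [N] ([htensP]), which for [V x] expresses that
    [p(T)^* = 0]. The subspace [G] is the range of [V] ([dilation_exists]).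

    Conversely, a unitary [U] as in the statement gives an isometry [V] into
    [N (x) D] intertwining the [T_i^*] with the backward shifts, so that
    [(T_w^* x)] has under [V] the coordinates [sqrt (b_v / b_(w v)) (V x)(w v)].
    Therefore the forms of [(id - Phi)^s (I)] and [Phi^k (I)] are diagonal in
    the coordinates of [V x]: their entries are the quotients by [b] of the
    coefficients of [(1 - a)^-(m-s)], which are nonnegative ([defect_diag]), and
    of [a^k b], which are at most one and vanish on words shorter than [k]
    ([iterPhi_diag], [iter_wconv_bounds]). The former gives membership in the
    domain, the latter purity; and [p(T)^* = 0] because [V] carries it to the
    equations of the variety. *)

(** * Inner products and orthogonal projection *)

Section InnerProduct.
Variables (R : realType) (H : hilbertType R).
Implicit Types (x y z : H) (c : R[i]).

Lemma hdotDl x y z : hdot (x + y) z = hdot x z + hdot y z.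
Proof. exact: linearDl. Qed.
Lemma hdotBl x y z : hdot (x - y) z = hdot x z - hdot y z.
Proof. exact: linearBl. Qed.
Lemma hdotZl c x z : hdot (c *: x) z = c * hdot x z.
Proof. exact: linearZl_LR. Qed.
Lemma hdotDr x y z : hdot z (x + y) = hdot z x + hdot z y.
Proof. exact: linearDr. Qed.
Lemma hdotBr x y z : hdot z (x - y) = hdot z x - hdot z y.
Proof. exact: linearBr. Qed.
Lemma hdotZr c x z : hdot z (c *: x) = Num.conj c * hdot z x.
Proof. exact: linearZr_LR. Qed.
Lemma hdot0l z : hdot 0 z = 0. Proof. exact: linear0l. Qed.
Lemma hdot0r z : hdot z 0 = 0. Proof. exact: linear0r. Qed.
Lemma hdotC x y : hdot x y = Num.conj (hdot y x).
Proof. by rewrite hermC expr0 mul1r. Qed.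
Lemma hdot_suml (I : Type) (s : seq I) (F : I -> H) z :
  hdot (\sum_(i <- s) F i) z = \sum_(i <- s) hdot (F i) z.
Proof. by elim/big_rec2: _ => [|i u v _ <-]; rewrite ?hdot0l ?hdotDl. Qed.
Lemma hdot_sumr (I : Type) (s : seq I) (F : I -> H) z :
  hdot z (\sum_(i <- s) F i) = \sum_(i <- s) hdot z (F i).
Proof. by elim/big_rec2: _ => [|i u v _ <-]; rewrite ?hdot0r ?hdotDr. Qed.

Lemma hdot_eq0 x : hdot x x = 0 -> x = 0.
Proof. by move/eqP; rewrite hdot_norm expf_eq0 /= normr_eq0 => /eqP. Qed.

Lemma hdot_extl x y : (forall z, hdot x z = hdot y z) -> x = y.
Proof.
by move=> h; apply/eqP; rewrite -subr_eq0; apply/eqP/hdot_eq0; rewrite hdotBl h subrr.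
Qed.

(** The squared norm as a real number: the norm of the space itself takes its
    values in the complex numbers. *)
Definition nsq x : R := complex.Re (hdot x x).

Lemma hdot_nsq x : hdot x x = (nsq x)%:C.
Proof. by rewrite /nsq RRe_real// hdot_norm realX. Qed.

Lemma norm_nsq x : `|x| ^+ 2 = (nsq x)%:C.
Proof. by rewrite -hdot_norm hdot_nsq. Qed.

Lemma nsq_ge0 x : 0 <= nsq x.
Proof. by rewrite -lecR -norm_nsq exprn_ge0. Qed.

Lemma nsq_eq0 x : nsq x = 0 -> x = 0.
Proof. by move=> h; apply: hdot_eq0; rewrite hdot_nsq h. Qed.

Lemma nsq0 : nsq 0 = 0.
Proof. by rewrite /nsq hdot0l. Qed.

Lemma nsqZ c x : (nsq (c *: x))%:C = `|c| ^+ 2 * (nsq x)%:C.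
Proof. by rewrite -!norm_nsq normrZ exprMn. Qed.

Lemma nsqZr (r : R) x : nsq (r%:C *: x) = r ^+ 2 * nsq x.
Proof.
apply/complexI; rewrite nsqZ rmorphM rmorphXn /=; congr (_ * _).
by rewrite -normrX ger0_norm// -rmorphXn lecR sqr_ge0.
Qed.

Lemma nsqN x : nsq (- x) = nsq x.
Proof. by apply/complexI; rewrite -!norm_nsq normrN. Qed.

Lemma norm_lt_nsq x (e : R) : 0 < e -> `|x| < e%:C <-> nsq x < e ^+ 2.
Proof.
move=> e0; rewrite -ltcR -norm_nsq rmorphXn /= ltr_pXn2r// nnegrE //.
by rewrite lecR ltW.
Qed.

Lemma norm_le_nsqe x (e : R) : 0 <= e -> `|x| <= e%:C <-> nsq x <= e ^+ 2.
Proof.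
by move=> e0; rewrite -lecR -norm_nsq rmorphXn /= ler_pXn2r// nnegrE // lecR.
Qed.

Lemma parallelogram x y : nsq (x + y) + nsq (x - y) = 2 * nsq x + 2 * nsq y.
Proof.
apply/complexI; rewrite !rmorphD !rmorphM /= -!hdot_nsq.
rewrite !hdotBl !hdotBr !hdotDl !hdotDr.
have -> : (2%:R : R)%:C = 2%:R :> R[i] by rewrite rmorph_nat.
by ring.
Qed.

End InnerProduct.

Section Projection.
Variables (R : realType) (H : hilbertType R).
Implicit Types (x y z : H) (c : R[i]).

Lemma hdot_cvgl (T : Type) (F : set_system T) (FF : Filter F) (f : T -> H) (y x : H) :
  f @ F --> y -> (fun t => hdot (f t) x : R[i]) @ F --> (hdot y x : R[i]).
Proof.
move=> /cvgrPdist_le hy; apply/cvgrPdist_le => e e0.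
have c0 : 0 < e / (`|x| + 1) by rewrite divr_gt0// ltr_wpDl.
apply: filterS (hy _ c0) => t ht; rewrite -hdotBl.
apply: le_trans (hdot_CauchySchwarz _ _) _.
apply: (@le_trans _ _ (e / (`|x| + 1) * `|x|)); first by rewrite ler_wpM2r.
rewrite mulrAC ler_pdivrMr ?ltr_wpDl// ler_wpM2l ?(ltW e0)//.
by rewrite lerDl.
Qed.

(** Moving from [y] towards [x] along [z] cannot get below the distance [D],
    which bounds the component of [x - y] along [z]. *)
Lemma dist_dot_bound (S : csubspace H) x y z (D : R) :
  (forall s, cs_set S s -> D <= nsq (x - s)) -> cs_set S y -> cs_set S z ->
  `|hdot (x - y) z| ^+ 2 <= ((nsq (x - y) - D) * nsq z)%:C.
Proof.
move=> hD Sy Sz; have [z0|z0] := eqVneq (nsq z) 0.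
  by rewrite (nsq_eq0 z0) hdot0r normr0 expr0n /= nsq0 mulr0.
have zp : 0 < nsq z by rewrite lt_neqAle eq_sym z0 nsq_ge0.
set w := x - y; pose t := hdot w z / (nsq z)%:C.
have zc : (nsq z)%:C != 0 by rewrite (inj_eq (@complexI _)).
have St : cs_set S (t *: z + y) by exact: csP.
have := hD _ St; rewrite -lecR -hdot_nsq.
have -> : x - (t *: z + y) = w - t *: z by rewrite /w opprD addrCA addrC.
have o : hdot (w - t *: z) z = 0 by rewrite hdotBl hdotZl hdot_nsq /t divfK// subrr.
rewrite hdotBr hdotZr o mulr0 subr0 hdotBl hdotZl /t => h.
have -> : `|hdot w z| ^+ 2 = hdot w z * hdot z w.
  by rewrite normCK [hdot z w]hdotC.
rewrite rmorphM rmorphB /= -ler_pdivrMr ?ltcR//.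
rewrite lerBrDl -lerBrDr; apply: le_trans h _.
by rewrite hdot_nsq lerD2l lerN2 mulrAC.
Qed.

(** A minimizing sequence for the distance to [S] is Cauchy by the
    parallelogram law, and its differences with [x] are asymptotically
    orthogonal to [S] by [dist_dot_bound]. *)
Lemma projection_ex (S : csubspace H) x :
  exists y : subsp S, forall z : subsp S, hdot (x - val y) (val z) = 0.
Proof.
pose E := [set nsq (x - s) | s in cs_set S].
have E0 : has_inf E.
  split; first by exists (nsq (x - 0)), 0 => //; exact: cs0.
  by exists 0 => _ [s _ <-]; exact: nsq_ge0.
pose D := inf E.
have hD s : cs_set S s -> D <= nsq (x - s).
  by move=> Ss; apply: ge_inf; [exact: E0.2|exists s].
have adh (k : nat) : exists s, cs_set S s /\ nsq (x - s) < D + k.+1%:R^-1.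
  have k0 : 0 < k.+1%:R^-1 :> R by rewrite invr_gt0.
  have [_ [s Ss <-] h] := inf_adherent k0 E0.
  by exists s.
have /choice[s hs] := adh.
have sC j k : nsq (s j - s k) <= 2 * (j.+1%:R^-1 + k.+1%:R^-1).
  have [Sj dj] := hs j; have [Sk dk] := hs k.
  have /hD mid : cs_set S (2^-1 *: (s j + s k)).
    rewrite -[X in cs_set S X]addr0; apply: csP; last exact: cs0.
    by rewrite -[s j]scale1r; exact: csP.
  have := parallelogram (x - s j) (x - s k).
  have -> : x - s j - (x - s k) = - (s j - s k) by rewrite opprB addrC addrA subrK opprB.
  have -> : x - s j + (x - s k) = (2 : R)%:C *: (x - 2^-1 *: (s j + s k)).
    rewrite scalerBr scalerA rmorph_nat divff ?pnatr_eq0// scale1r.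
    by rewrite scaler_nat mulr2n opprD addrACA.
  rewrite nsqZr nsqN; move: mid dj dk.
  by move: (j.+1%:R^-1) (k.+1%:R^-1) (nsq (x - s j)) (nsq (x - s k)) => *; lra.
have : cvg (s @ \oo).
  apply: cauchy_cvg; apply/cauchy_exP => e e0.
  have eE : e = (complex.Re e)%:C by rewrite RRe_real// gtr0_real.
  have r0 : 0 < complex.Re e by rewrite -ltcR -eE.
  set r := complex.Re e in eE r0.
  have [N hN] : exists N : nat, 4 * N.+1%:R^-1 < r ^+ 2.
    have c0 : 0 < r ^+ 2 / 4 by rewrite divr_gt0// exprn_gt0.
    have /cvgrPdist_lt /(_ _ c0)[N _ /(_ N)] := @cvg_harmonic R.
    rewrite /= leqnn sub0r normrN => /(_ isT); rewrite ger0_norm ?invr_ge0// => h.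
    by exists N; rewrite mulrC -ltr_pdivlMr.
  exists (s N), N => // k /= Nk; rewrite -ball_normE /= eE.
  apply/norm_lt_nsq => //; apply: le_lt_trans (sC _ _) _; apply: le_lt_trans hN.
  have : k.+1%:R^-1 <= N.+1%:R^-1 :> R.
    by rewrite lef_pV2 ?posrE// ler_nat.
  by move: (k.+1%:R^-1) (N.+1%:R^-1) => *; lra.
move=> /cvg_ex[y hy].
have Sy : cs_set S y.
  apply: (@closed_cvg _ _ (s @ \oo) _ id _ (@cs_closed _ _ S) _ _ hy).
  by exists 0%N => // k _ /=; exact: (hs k).1.
exists (Subsp (mem_set Sy)) => z /=.
have Sz : cs_set S (val z) by exact: set_mem (valP z).
have lim0 : (fun k => hdot (x - s k) (val z) : R[i]) @ \oo --> (0 : R[i]).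
  apply/cvgrPdist_le => e e0.
  have eE : e = (complex.Re e)%:C by rewrite RRe_real// gtr0_real.
  have r0 : 0 < complex.Re e by rewrite -ltcR -eE.
  set r := complex.Re e in eE r0.
  have c0 : 0 < r ^+ 2 / (nsq (val z) + 1) by rewrite divr_gt0 ?exprn_gt0// ltr_wpDl// nsq_ge0.
  have /cvgrPdist_lt /(_ _ c0) := @cvg_harmonic R.
  apply: filterS => k; rewrite !sub0r !normrN ger0_norm ?invr_ge0// => h.
  rewrite -(@ler_pXn2r _ 2)// ?nnegrE ?(ltW e0)//.
  apply: le_trans (dist_dot_bound hD (hs k).1 Sz) _.
  rewrite eE -rmorphXn /= lecR.
  have h1 := (hs k).2; have h2 := nsq_ge0 (val z).
  apply: le_trans (_ : k.+1%:R^-1 * nsq (val z) <= _).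
    by rewrite ler_wpM2r//; move: h1; rewrite lerBlDl => /ltW.
  move: h; rewrite /harmonic ltr_pdivlMr ?ltr_wpDl// mulrDr mulr1 => h.
  have : 0 <= k.+1%:R^-1 :> R by rewrite invr_ge0.
  by move: h => /=; move: (k.+1%:R^-1) => v; move: (v * _) (r ^+ 2) => *; lra.
have lim1 : (fun k => hdot (x - s k) (val z) : R[i]) @ \oo --> (hdot (x - y) (val z) : R[i]).
  by apply: hdot_cvgl; apply: (cvgB (cvg_cst x) hy).
exact: (cvg_unique (@norm_hausdorff _ _) lim1 lim0).
Qed.

End Projection.

(** * Bounded operators and their adjoints *)

Section BoundedOperators.
Variable R : realType.

Lemma op_lin0 (H K : hilbertType R) (A : H -> K) : linear A -> A 0 = 0.
Proof. by move=> hA; rewrite -[X in A X](addNr 0) -{1}[0]scale1r -scaleNr hA scaleN1r addNr. Qed.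

Lemma op_linD (H K : hilbertType R) (A : H -> K) x y : linear A -> A (x + y) = A x + A y.
Proof. by move=> hA; rewrite -{1}[x]scale1r hA scale1r. Qed.

Lemma op_linZ (H K : hilbertType R) (A : H -> K) c x : linear A -> A (c *: x) = c *: A x.
Proof. by move=> hA; rewrite -{1}[c *: x]addr0 hA op_lin0// addr0. Qed.

Lemma op_linN (H K : hilbertType R) (A : H -> K) x : linear A -> A (- x) = - A x.
Proof. by move=> hA; rewrite -scaleN1r op_linZ// scaleN1r. Qed.

Lemma op_linB (H K : hilbertType R) (A : H -> K) x y : linear A -> A (x - y) = A x - A y.
Proof. by move=> hA; rewrite op_linD// op_linN. Qed.

Lemma op_lin_sum (H K : hilbertType R) (A : H -> K) (I : Type) (s : seq I) (F : I -> H) :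
  linear A -> A (\sum_(i <- s) F i) = \sum_(i <- s) A (F i).
Proof.
by move=> hA; elim/big_rec2: _ => [|i u v _ <-]; rewrite ?op_lin0 ?op_linD.
Qed.

(** Squared norms are real numbers and compose without square roots. *)
Definition bounded_by (H K : hilbertType R) (A : H -> K) (M : R) : Prop :=
  forall x, nsq (A x) <= M * nsq x.

Lemma bounded_opP (H K : hilbertType R) (A : H -> K) :
  bounded_op A <-> linear A /\ exists2 M, 0 <= M & bounded_by A M.
Proof.
split=> [[lA cA]|[lA [M M0 hM]]]; split=> //.
  have /cvgrPdist_lt /(_ 1 ltr01) := cA 0.
  rewrite op_lin0// => /nbhs_normP[d /= d0 hd].
  have dE : d = (complex.Re d)%:C by rewrite RRe_real// gtr0_real.
  have r0 : 0 < complex.Re d by rewrite -ltcR -dE.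
  set r := complex.Re d in dE r0.
  (* [x] is rescaled by [t] to norm [r / 2], inside the ball where [A] is at
     most one. *)
  exists ((2 / r) ^+ 2); first exact: sqr_ge0.
  move=> x; have [x0|x0] := eqVneq (nsq x) 0.
    by rewrite (nsq_eq0 x0) op_lin0// !nsq0 mulr0.
  have xp : 0 < nsq x by rewrite lt_neqAle eq_sym x0 nsq_ge0.
  have sp : 0 < Num.sqrt (nsq x) by rewrite sqrtr_gt0.
  pose t := r / 2 / Num.sqrt (nsq x).
  have t0 : 0 < t by rewrite /t !divr_gt0.
  have tE : t ^+ 2 * nsq x = (r / 2) ^+ 2.
    by rewrite /t [in LHS]expr_div_n sqr_sqrtr ?nsq_ge0// divfK.
  have : `|0 - A (t%:C *: x)| < 1.
    apply: hd; rewrite /= sub0r normrN dE; apply/norm_lt_nsq => //.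
    rewrite nsqZr tE ltrXn2r// ?ltr_pdivrMr ?ltr_pMr ?ltr1n//.
    by rewrite divr_ge0// ltW.
  rewrite sub0r normrN -[1]/(1%:C); move/(norm_lt_nsq _ ltr01).
  rewrite op_linZ// nsqZr expr1n => h.
  have -> : (2 / r) ^+ 2 * nsq x = t ^- 2.
    have -> : nsq x = (r / 2) ^+ 2 / t ^+ 2 by rewrite -tE mulrAC divff ?mul1r// expf_neq0 ?gt_eqF.
    rewrite mulrA -exprMn mulrA divfK ?gt_eqF// divff ?pnatr_eq0//.
    by rewrite expr1n mul1r.
  by rewrite -[t ^- 2]mul1r ler_pdivlMr ?exprn_gt0// mulrC ltW.
move=> x; apply/cvgrPdist_le => e e0.
have eE : e = (complex.Re e)%:C by rewrite RRe_real// gtr0_real.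
have r0 : 0 < complex.Re e by rewrite -ltcR -eE.
set r := complex.Re e in eE r0.
pose s := Num.sqrt (M + 1).
have M1 : 0 < M + 1 by rewrite ltr_wpDl.
have s0 : 0 < s by rewrite sqrtr_gt0.
have c0 : 0 < (r / s)%:C by rewrite ltcR divr_gt0.
have /cvgrPdist_le hx : (fun z : H => z) @ nbhs x --> x by exact: cvg_id.
apply: filterS (hx _ c0) => y.
have rs : 0 <= r / s by rewrite divr_ge0// ltW.
move/(norm_le_nsqe _ rs) => h; rewrite -op_linB// eE.
apply/(norm_le_nsqe _ (ltW r0)); apply: le_trans (hM _) _.
apply: (@le_trans _ _ ((M + 1) * (r / s) ^+ 2)).
  by apply: ler_pM => //; [exact: nsq_ge0|rewrite lerDl].
by rewrite expr_div_n sqr_sqrtr ?(ltW M1)// mulrC divfK// gt_eqF.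
Qed.

Lemma bounded_op_comp (H K L : hilbertType R) (A : K -> L) (B : H -> K) :
  bounded_op A -> bounded_op B -> bounded_op (A \o B).
Proof.
move=> /bounded_opP[lA [M M0 hM]] /bounded_opP[lB [N N0 hN]]; apply/bounded_opP.
split=> [c x y /=|]; first by rewrite lB lA.
exists (M * N); first exact: mulr_ge0.
by move=> x /=; apply: le_trans (hM _) _; rewrite -mulrA ler_wpM2l.
Qed.

Lemma bounded_op_id (H : hilbertType R) : bounded_op (@id H).
Proof.
by apply/bounded_opP; split=> //; exists 1 => // x; rewrite mul1r.
Qed.

Lemma nsqB_le (H : hilbertType R) (x y : H) : nsq (x - y) <= 2 * nsq x + 2 * nsq y.
Proof. by rewrite -parallelogram lerDr nsq_ge0. Qed.

Lemma bounded_opB (H K : hilbertType R) (A B : H -> K) :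
  bounded_op A -> bounded_op B -> bounded_op (fun x => A x - B x).
Proof.
move=> /bounded_opP[lA [M M0 hM]] /bounded_opP[lB [N N0 hN]]; apply/bounded_opP.
split=> [c x y|]; first by rewrite lB lA scalerBr opprD addrACA.
exists (2 * M + 2 * N); first by rewrite addr_ge0 ?mulr_ge0.
move=> x; apply: le_trans (nsqB_le _ _) _; rewrite [leRHS]mulrDl -!mulrA.
by rewrite lerD// ler_wpM2l.
Qed.

Lemma bounded_opZ (H K : hilbertType R) (A : H -> K) (c : R) :
  bounded_op A -> bounded_op (fun x => c%:C *: A x).
Proof.
move=> /bounded_opP[lA [M M0 hM]]; apply/bounded_opP.
split=> [d x y|]; first by rewrite lA scalerDr !scalerA mulrC.
exists (c ^+ 2 * M); first by rewrite mulr_ge0 ?sqr_ge0.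
by move=> x; rewrite nsqZr -mulrA ler_wpM2l ?sqr_ge0.
Qed.

Lemma orth_projP (H : hilbertType R) (S : csubspace H) x (z : subsp S) :
  hdot (x - val (orth_proj S x)) (val z) = 0.
Proof.
have [y hy] := projection_ex S x.
exact: (@getPex _ [set y : subsp S | forall z : subsp S, hdot (x - val y) (val z) = 0]
  (ex_intro _ y hy)).
Qed.

(** The form [x |-> <A x, y>] is represented by a multiple of a vector
    orthogonal to its kernel. *)
Lemma riesz (H K : hilbertType R) (A : H -> K) (y : K) : bounded_op A ->
  exists z, forall x, hdot (A x) y = hdot x z.
Proof.
move=> bA; have lA := bA.1.
have k0 : hdot (A 0) y = 0 by rewrite op_lin0// hdot0l.
have kP (c : R[i]) u v : hdot (A u) y = 0 -> hdot (A v) y = 0 -> hdot (A (c *: u + v)) y = 0.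
  by move=> hu hv; rewrite lA hdotDl hdotZl hu hv mulr0 addr0.
(* The kernel is the preimage of the closed set [orth [set y]]. *)
have kC : closed [set x | hdot (A x) y = 0].
  move=> x xc; have : closure (orth [set y]) (A x).
    move=> B /(bA.2 x)/xc[z [/= hz Bz]]; exists (A z); split=> //.
    by move=> w ->.
  by move=> /orth_closed; apply.
pose S := @CSubspace R H [set x | hdot (A x) y = 0] k0 kP kC.
have [h|/existsNP[x /eqP x0]] := pselect (forall x, hdot (A x) y = 0).
  by exists 0 => x; rewrite h hdot0r.
pose p := orth_proj S x; pose w := x - val p.
have wo v : hdot (A v) y = 0 -> hdot v w = 0.
  move=> Av; rewrite hdotC; have := orth_projP (S := S) x (Subsp (mem_set (Av : cs_set S v))).
  by move=> /= ->; rewrite rmorph0.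
have Aw : hdot (A w) y != 0.
  have : hdot (A (val p)) y = 0 by exact: (set_mem (valP p)).
  by rewrite /w op_linB// hdotBl => ->; rewrite subr0.
have ww : hdot w w != 0.
  apply/eqP => /hdot_eq0 w0; move: Aw; rewrite w0 op_lin0// hdot0l eqxx.
  by [].
exists (Num.conj (hdot (A w) y / hdot w w) *: w) => v.
have : hdot (v - (hdot (A v) y / hdot (A w) y) *: w) w = 0.
  by apply: wo; rewrite op_linB// op_linZ// hdotBl hdotZl divfK// subrr.
rewrite hdotBl hdotZl => /eqP; rewrite subr_eq0 => /eqP vw.
by rewrite hdotZr conjCK vw; field; rewrite ww Aw.
Qed.

Lemma adjoint_uniq (H K : hilbertType R) (A : H -> K) (B : K -> H) :
  (forall x y, hdot (A x) y = hdot x (B y)) -> adjoint A = B.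
Proof.
move=> hB; have := @getPex _ [set B : K -> H | forall x y, hdot (A x) y = hdot x (B y)]
  (ex_intro _ B hB).
rewrite -/(adjoint A) /= => h; apply/funext => y; apply: hdot_extl => z.
by rewrite hdotC -h hB -hdotC.
Qed.

Lemma adjointP (H K : hilbertType R) (A : H -> K) : bounded_op A ->
  forall x y, hdot (A x) y = hdot x (adjoint A y).
Proof.
move=> bA; have /choice[B hB] : forall y, exists z, forall x, hdot (A x) y = hdot x z.
  by move=> y; exact: riesz.
by rewrite (@adjoint_uniq _ _ A B).
Qed.

Lemma adjointPr (H K : hilbertType R) (A : H -> K) : bounded_op A ->
  forall x y, hdot (adjoint A y) x = hdot y (A x).
Proof. by move=> bA x y; rewrite hdotC -adjointP// -hdotC. Qed.

Lemma hdot_CS_nsq (H : hilbertType R) (x y : H) :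
  `|hdot x y| ^+ 2 <= (nsq x * nsq y)%:C.
Proof.
apply: le_trans (dot_CauchySchwarz _ _ _) _.
by rewrite !hdot_nsq rmorphM.
Qed.

(** Apply the Cauchy-Schwarz inequality to [<A z, y> = |z|^2], where
    [z = A^* y]. *)
Lemma adjoint_bounded_by (H K : hilbertType R) (A : H -> K) M : bounded_op A -> 0 <= M ->
  bounded_by A M -> bounded_by (adjoint A) M.
Proof.
move=> bA M0 hM y; set z := adjoint A y.
have [z0|z0] := eqVneq (nsq z) 0; first by rewrite z0 mulr_ge0// nsq_ge0.
have zp : 0 < nsq z by rewrite lt_neqAle eq_sym z0 nsq_ge0.
have := hdot_CS_nsq (A z) y.
rewrite adjointP// -/z hdot_nsq ger0_norm ?lecR ?nsq_ge0// -rmorphXn /= lecR => h.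
rewrite -(ler_pM2l zp) -expr2; apply: le_trans h _.
by rewrite mulrA [_ * M]mulrC ler_wpM2r ?nsq_ge0.
Qed.

Lemma adjoint_bounded (H K : hilbertType R) (A : H -> K) :
  bounded_op A -> bounded_op (adjoint A).
Proof.
move=> bA; have /bounded_opP[lA [M M0 hM]] := bA; apply/bounded_opP; split.
  move=> c x y; apply: hdot_extl => z.
  by rewrite hdotDl hdotZl !adjointPr// hdotDl hdotZl.
by exists M => //; exact: adjoint_bounded_by.
Qed.

Lemma adjoint_comp (H K L : hilbertType R) (A : K -> L) (B : H -> K) :
  bounded_op A -> bounded_op B -> adjoint (A \o B) = adjoint B \o adjoint A.
Proof. by move=> bA bB; apply: adjoint_uniq => x y /=; rewrite !adjointP. Qed.

Lemma adjoint_id (H : hilbertType R) : adjoint (@id H) = id.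
Proof. exact: adjoint_uniq. Qed.

End BoundedOperators.

(** * Positive operators and their square roots *)

Lemma conj_realC (R : realType) (r : R) : Num.conj (r%:C : R[i]) = r%:C.
Proof. by apply: conj_Creal; rewrite complex_real. Qed.

Section RealNorm.
Variables (R : realType) (H : hilbertType R).
Implicit Types (x y z : H) (c : R[i]).

Definition rnorm x : R := Num.sqrt (nsq x).

Lemma rnorm_ge0 x : 0 <= rnorm x. Proof. exact: sqrtr_ge0. Qed.

Lemma rnorm_sq x : rnorm x ^+ 2 = nsq x.
Proof. by rewrite sqr_sqrtr// nsq_ge0. Qed.

Lemma normE x : `|x| = (rnorm x)%:C.
Proof.
apply/eqP; rewrite -(@eqrXn2 _ 2)// ?lecR ?rnorm_ge0//.
by rewrite norm_nsq -rmorphXn /= rnorm_sq.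
Qed.

Lemma rnorm_leq x y : (rnorm x <= rnorm y) = (nsq x <= nsq y).
Proof. by rewrite ler_sqrt// nsq_ge0. Qed.

Lemma rnormD x y : rnorm (x + y) <= rnorm x + rnorm y.
Proof. by rewrite -lecR rmorphD /= -!normE ler_normD. Qed.

Lemma rnormN x : rnorm (- x) = rnorm x.
Proof. by rewrite /rnorm nsqN. Qed.

Lemma rnorm_distC x y : rnorm (x - y) = rnorm (y - x).
Proof. by rewrite -rnormN opprB. Qed.

Lemma rnormZr (r : R) x : rnorm (r%:C *: x) = `|r| * rnorm x.
Proof. by rewrite /rnorm nsqZr sqrtrM ?sqr_ge0// sqrtr_sqr. Qed.

Lemma rnorm0_eq0 x : rnorm x <= 0 -> x = 0.
Proof.
move=> h; apply: nsq_eq0; have : rnorm x == 0 by rewrite eq_le h rnorm_ge0.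
by rewrite sqrtr_eq0 => h'; apply/eqP; rewrite eq_le h' nsq_ge0.
Qed.

Lemma rnorm0 : rnorm (0 : H) = 0.
Proof. by rewrite /rnorm nsq0 sqrtr0. Qed.

Lemma rnorm_tri x y z : rnorm (x - z) <= rnorm (x - y) + rnorm (y - z).
Proof. by rewrite -[x - z](subrKA y) rnormD. Qed.

Lemma hdot_rnorm x y : `|hdot x y| <= (rnorm x * rnorm y)%:C.
Proof. by rewrite rmorphM /= -!normE hdot_CauchySchwarz. Qed.

Lemma rnormZ c x : (rnorm (c *: x))%:C = `|c| * (rnorm x)%:C.
Proof. by rewrite -!normE normrZ. Qed.

(** The norm is complex valued; here error bounds are real, hence totally
    ordered. *)
Definition ncvg (u : nat -> H) (l : H) : Prop :=
  forall e : R, 0 < e -> exists N, forall k, (N <= k)%N -> rnorm (u k - l) <= e.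

Lemma ncvg_squeeze (u v w : nat -> H) (l p q : H) :
  ncvg u l -> ncvg v p ->
  (forall k, rnorm (w k - q) <= rnorm (u k - l) + rnorm (v k - p)) -> ncvg w q.
Proof.
move=> hu hv h e e0; have e2 : 0 < e / 2 by rewrite divr_gt0.
have [N hN] := hu _ e2; have [N' hN'] := hv _ e2.
exists (maxn N N') => k; rewrite geq_max => /andP[k1 k2].
by apply: le_trans (h k) _; rewrite [leRHS]splitr lerD ?hN ?hN'.
Qed.

Lemma ncvg_uniq u (l p : H) : ncvg u l -> ncvg u p -> l = p.
Proof.
move=> hu hv; apply/eqP; rewrite -subr_eq0; apply/eqP/rnorm0_eq0.
apply/ler_addgt0Pl => e e0; rewrite addr0.
have : ncvg (fun k => l) p.
  apply: (ncvg_squeeze hu hv) => k.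
  by rewrite (rnorm_distC (u k)) rnorm_tri.
by move=> /(_ e e0)[N /(_ N)]; apply.
Qed.

Lemma ncvgD u v (l p : H) : ncvg u l -> ncvg v p -> ncvg (fun k => u k + v k) (l + p).
Proof.
by move=> hu hv; apply: (ncvg_squeeze hu hv) => k; rewrite opprD addrACA rnormD.
Qed.

Lemma ncvgZ (c : R[i]) u (l : H) : ncvg u l -> ncvg (fun k => c *: u k) (c *: l).
Proof.
move=> hu e e0; pose m := complex.Re `|c| + 1.
have cE : `|c| = (complex.Re `|c|)%:C by rewrite RRe_real ?normr_real.
have cm : `|c| <= m%:C by rewrite [leLHS]cE lecR lerDl.
have m0 : 0 < m.
  by rewrite ltr_wpDl// -lecR -cE; exact: normr_ge0.
have [N hN] := hu (e / m) (divr_gt0 e0 m0).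
exists N => k /hN h; rewrite -scalerBr -lecR rnormZ.
apply: le_trans (_ : m%:C * (e / m)%:C <= _).
  by apply: ler_pM => //; rewrite ?lecR// rnorm_ge0.
by rewrite -rmorphM /= mulrC divfK// gt_eqF.
Qed.

Lemma ncvgP (u : nat -> H) l : u @ \oo --> l <-> ncvg u l.
Proof.
split=> [/cvgrPdist_le h e e0|h].
  have /h[N _ hN] : 0 < e%:C by rewrite ltcR.
  by exists N => k /hN /=; rewrite normE lecR rnorm_distC.
apply/cvgrPdist_le => e e0.
have eE : e = (complex.Re e)%:C by rewrite RRe_real// gtr0_real.
have r0 : 0 < complex.Re e by rewrite -ltcR -eE.
have [N hN] := h _ r0; exists N => // k /= /hN.
by rewrite normE eE lecR rnorm_distC.
Qed.

Lemma ncvg_cauchy (u : nat -> H) :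
  (forall e : R, 0 < e -> exists N, forall k, (N <= k)%N -> rnorm (u k - u N) <= e) ->
  exists l, ncvg u l.
Proof.
move=> h; have : cvg (u @ \oo).
  apply: cauchy_cvg; apply/cauchy_exP => e e0.
  have eE : e = (complex.Re e)%:C by rewrite RRe_real// gtr0_real.
  have r0 : 0 < complex.Re e by rewrite -ltcR -eE.
  have r2 : 0 < complex.Re e / 2 by rewrite divr_gt0.
  have [N hN] := h _ r2; exists (u N), N => // k /= /hN hk.
  rewrite -ball_normE /= normE eE ltcR rnorm_distC.
  by apply: le_lt_trans hk _; rewrite ltr_pdivrMr// ltr_pMr// ltr1n.
by move=> /cvg_ex[l /ncvgP hl]; exists l.
Qed.

End RealNorm.

Section PositiveOperators.
Variables (R : realType) (H : hilbertType R).
Implicit Types (A : H -> H).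

Definition qform A (x : H) : R := complex.Re (hdot (A x) x).

Lemma qform_id x : qform id x = nsq x. Proof. by []. Qed.

Lemma pos_qform A x : positive_op A -> hdot (A x) x = (qform A x)%:C.
Proof. by move=> [_ h]; rewrite /qform RRe_real// ger0_real. Qed.

Lemma pos_qform_ge0 A x : positive_op A -> 0 <= qform A x.
Proof. by move=> h; rewrite -lecR -pos_qform//; exact: h.2. Qed.

Lemma Im_real (z : R[i]) : z \is Num.real -> complex.Im z = 0.
Proof. by case: z => u v; rewrite complex_real => /eqP. Qed.

(** Polarization: the imaginary parts of the diagonal values at [x + y] and
    at [x + 'i y] determine [<A y, x>] from [<A x, y>]. *)
Lemma real_form_selfadjoint A : linear A -> (forall x, hdot (A x) x \is Num.real) ->
  forall x y, hdot (A x) y = hdot x (A y).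
Proof.
move=> lA hr x y.
have i1 : complex.Im (hdot (A x) y) + complex.Im (hdot (A y) x) = 0.
  have := Im_real (hr (x + y)).
  rewrite op_linD// hdotDl !hdotDr !raddfD /= (Im_real (hr x)) (Im_real (hr y)).
  by rewrite add0r addr0.
have i2 : complex.Re (hdot (A y) x) = complex.Re (hdot (A x) y).
  have := Im_real (hr (x + 'i *: y)).
  rewrite op_linD// op_linZ// hdotDl !hdotDr !hdotZl !hdotZr.
  rewrite !raddfD /= (Im_real (hr x)).
  have -> : 'i * (Num.conj 'i * hdot (A y) y) = hdot (A y) y.
    by rewrite mulrA -normCK normc_i expr1n mul1r.
  rewrite (Im_real (hr y)) add0r addr0.
  case: (hdot (A x) y) (hdot (A y) x) => [u v] [u' v'] /=.
  by move=> h; lra.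
rewrite [RHS]hdotC.
case: (hdot (A x) y) (hdot (A y) x) i1 i2 => [u v] [u' v'] /= h ->.
by apply/eqP; rewrite eq_complex /= eqxx /= -addr_eq0 h.
Qed.

Lemma pos_selfadjoint A : positive_op A -> forall x y, hdot (A x) y = hdot x (A y).
Proof.
move=> [bA pA]; apply: real_form_selfadjoint; first exact: bA.1.
by move=> x; exact: ger0_real.
Qed.

Lemma bounded_qform A : bounded_op A -> exists2 M, 0 < M & forall x, qform A x <= M * nsq x.
Proof.
move=> /bounded_opP[lA [M M0 hM]]; exists (M + 1); first by rewrite ltr_wpDl.
move=> x; have := hdot_CS_nsq (A x) x.
have : (qform A x ^+ 2)%:C <= `|hdot (A x) x| ^+ 2.
  rewrite -(real_normK (num_real (qform A x))) rmorphXn lerXn2r ?nnegrE ?normr_ge0 //; first by rewrite lecR.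
  exact: normc_Re_le.
move=> /le_trans h /h; rewrite lecR => {}h.
have : qform A x ^+ 2 <= ((M + 1) * nsq x) ^+ 2.
  apply: le_trans h _.
  apply: le_trans (_ : M * nsq x * nsq x <= _).
    by rewrite ler_wpM2r ?nsq_ge0.
  rewrite -mulrA -expr2 exprMn ler_wpM2r ?sqr_ge0//.
  by rewrite sqrrD1; nra.
move=> h2; apply: le_trans (ler_norm _) _; rewrite -ler_sqr ?nnegrE// ?real_normK ?num_real//.
by rewrite mulr_ge0 ?nsq_ge0// addr_ge0.
Qed.

(** The form is nonnegative at [x - t A x], where [t] is the inverse of the
    bound [M]; this replaces the Cauchy-Schwarz inequality for the degenerate
    form [<A x, y>]. *)
Lemma pos_nsq_le A M : positive_op A -> 0 < M ->
  (forall x, qform A x <= M * nsq x) -> forall x, nsq (A x) <= M * qform A x.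
Proof.
move=> pA M0 hM x; set z := A x; have lA := pA.1.1.
pose t := M^-1; have := pos_qform_ge0 (x - t%:C *: z) pA.
have -> : qform A (x - t%:C *: z) = qform A x - 2 * t * nsq z + t ^+ 2 * qform A z.
  apply/complexI; rewrite -pos_qform// (op_linB _ _ lA) (op_linZ _ _ lA).
  rewrite hdotBl !hdotBr !hdotZl !hdotZr (pos_selfadjoint pA z) -/z.
  rewrite !rmorphD rmorphN !rmorphM /= -!pos_qform// hdot_nsq.
  rewrite !conj_realC.
  have -> : hdot (A x) x = hdot z x by [].
  by rewrite rmorph_nat; ring.
have tM : t * M = 1 by rewrite mulVf ?gt_eqF.
have t0 : 0 < t by rewrite invr_gt0.
have h1 := hM z; have n0 := nsq_ge0 z.
have h2 : t ^+ 2 * qform A z <= t * nsq z.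
  by rewrite expr2 -mulrA ler_wpM2l ?(ltW t0)// -ler_pdivlMl// invrK.
move=> h3; rewrite mulrC -ler_pdivrMr// -/t mulrC; lra.
Qed.

End PositiveOperators.

Section SquareRoot.
Variables (R : realType) (H : hilbertType R) (B : H -> H).
Hypothesis pB : positive_op B.
Hypothesis B1 : forall x, nsq (B x) <= nsq x.

(** The square root of [1 - B] is [1 - Y], where [Y] solves
    [Y = (B + Y^2) / 2]; the iterates of this equation from [0] converge
    because their increments are dominated by those of the scalar iteration
    with [B] replaced by [1]. *)
Fixpoint sqrt_iter (k : nat) : H -> H :=
  if k is j.+1 then fun x => (2^-1 : R)%:C *: (B x + sqrt_iter j (sqrt_iter j x))
  else fun=> 0.

Fixpoint scal_iter (k : nat) : R :=
  if k is j.+1 then 2^-1 * (1 + scal_iter j ^+ 2) else 0.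

Let Y := sqrt_iter.
Let t := scal_iter.

Lemma scal_iter_bound k : [/\ 0 <= t k, t k <= 1 & t k <= t k.+1].
Proof.
elim: k => [|k [h0 h1 h2]]; first by split=> //=; nra.
by split; rewrite /t /=; rewrite -/t; move: h0 h1 h2; rewrite /t /= -/t; nra.
Qed.

Lemma sqrt_iter_lin k : linear (Y k).
Proof.
elim: k => [|k IH] c x y /=; first by rewrite scaler0 addr0.
rewrite pB.1.1 !IH addrACA [LHS]scalerDr; congr (_ + _).
by rewrite -scalerDr !scalerA mulrC.
Qed.

Lemma B_rnorm x : rnorm (B x) <= rnorm x.
Proof. by rewrite rnorm_leq B1. Qed.

Lemma half_norm : `|(2^-1 : R)| = 2^-1.
Proof. by rewrite ger0_norm. Qed.

Lemma sqrt_iter_bound k x : rnorm (Y k x) <= t k * rnorm x.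
Proof.
elim: k x => [|k IH] x /=; first by rewrite rnorm0 mul0r.
have [h0 h1 h2] := scal_iter_bound k.
rewrite rnormZr half_norm -mulrA ler_wpM2l//.
apply: le_trans (rnormD _ _) _; rewrite mulrDl mul1r lerD ?B_rnorm//.
apply: le_trans (IH _) _; rewrite expr2 -mulrA ler_wpM2l//; exact: IH.
Qed.

(** From [Y^2 - Z^2 = Y (Y - Z) + (Y - Z) Z], which holds without
    commutation and matches the scalar factorization of [s^2 - t^2]. *)
Lemma sqrt_iter_step k x : rnorm (Y k.+1 x - Y k x) <= (t k.+1 - t k) * rnorm x.
Proof.
elim: k x => [|k IH] x.
  rewrite /Y /= subr0 addr0 rnormZr half_norm expr0n /= addr0 mulr1 subr0.
  by rewrite ler_wpM2l// B_rnorm.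
have [h0 h1 h2] := scal_iter_bound k.
have [h3 h4 h5] := scal_iter_bound k.+1.
have -> : Y k.+2 x - Y k.+1 x = (2^-1 : R)%:C *: (Y k.+1 (Y k.+1 x - Y k x)
    + (Y k.+1 (Y k x) - Y k (Y k x))).
  rewrite (op_linB _ _ (sqrt_iter_lin k.+1)) addrA subrK.
  rewrite {1}/Y [sqrt_iter k.+2]/= {2}/Y [X in _ - X = _]/= -scalerBr.
  by rewrite opprD addrACA subrr add0r.
have -> : t k.+2 - t k.+1 = 2^-1 * (t k.+1 * (t k.+1 - t k) + (t k.+1 - t k) * t k).
  have E j : t j.+1 = 2^-1 * (1 + t j ^+ 2) by [].
  by rewrite (E k.+1) [X in _ - X = _]E; field.
rewrite rnormZr half_norm -mulrA ler_wpM2l//.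
apply: le_trans (rnormD _ _) _; rewrite mulrDl lerD//.
  apply: le_trans (sqrt_iter_bound _ _) _; rewrite -mulrA ler_wpM2l//.
apply: le_trans (IH _) _; rewrite -mulrA ler_wpM2l ?subr_ge0//.
exact: sqrt_iter_bound.
Qed.

Lemma sqrt_iter_cauchy k j x : rnorm (Y (k + j) x - Y k x) <= (t (k + j) - t k) * rnorm x.
Proof.
elim: j => [|j IH]; first by rewrite addn0 !subrr rnorm0 mul0r.
apply: le_trans (rnorm_tri _ (Y (k + j) x) _) _.
have -> : t (k + j.+1) - t k = (t (k + j).+1 - t (k + j)) + (t (k + j) - t k).
  by rewrite addnS; ring.
by rewrite mulrDl lerD// addnS sqrt_iter_step.
Qed.

Lemma sqrt_iter_cvg x : exists y, ncvg (Y^~ x) y.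
Proof.
apply: ncvg_cauchy => e e0.
have st : has_sup (range t).
  by split; [exists (t 0%N), 0%N|exists 1 => _ [k _ <-]; have [] := scal_iter_bound k].
have d0 : 0 < rnorm x + 1 by rewrite ltr_wpDl// rnorm_ge0.
have c0 : 0 < e / (rnorm x + 1) by rewrite divr_gt0.
have [_ [N _ <-] hN] := sup_adherent c0 st.
exists N => k /subnKC <-; apply: le_trans (sqrt_iter_cauchy _ _ _) _.
set j := (k - N)%N.
have ht : t (N + j) <= sup (range t) by apply: sup_upper_bound => //; exists (N + j)%N.
apply: le_trans (_ : e / (rnorm x + 1) * rnorm x <= _).
  by rewrite ler_wpM2r ?rnorm_ge0//; move: hN ht; lra.
by rewrite mulrAC ler_pdivrMr// ler_wpM2l ?(ltW e0)// lerDl.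
Qed.

Lemma sqrt_iter_sym k x y : hdot (Y k x) y = hdot x (Y k y).
Proof.
elim: k x y => [|k IH] x y /=; first by rewrite hdot0l hdot0r.
by rewrite hdotZl hdotZr conj_realC hdotDl hdotDr !IH pos_selfadjoint.
Qed.

Lemma sqrt_contraction : exists S : H -> H, positive_op S /\ forall x, S (S x) = x - B x.
Proof.
have /choice[Z hZ] := sqrt_iter_cvg.
have Zlin : linear Z.
  move=> c x y; apply: ncvg_uniq (hZ _) _.
  have -> : Y^~ (c *: x + y) = (fun k => c *: Y k x + Y k y).
    by apply/funext => k; exact: sqrt_iter_lin.
  by apply: ncvgD => //; exact: ncvgZ.
have Ybd k x : rnorm (Y k x) <= rnorm x.
  have [h0 h1 _] := scal_iter_bound k; apply: le_trans (sqrt_iter_bound _ _) _.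
  by rewrite -[leRHS]mul1r ler_wpM2r ?rnorm_ge0.
have Zbd x : rnorm (Z x) <= rnorm x.
  apply/ler_addgt0Pl => e e0; have [N /(_ N (leqnn _)) h] := hZ x e e0.
  have -> : Z x = (Z x - Y N x) + Y N x by rewrite subrK.
  by apply: le_trans (rnormD _ _) _; rewrite rnorm_distC lerD.
have Zsym x y : hdot (Z x) y = hdot x (Z y).
  apply/eqP; rewrite -subr_eq0 -normr_le0; apply: le_limC => e e0.
  exists 0 => //; rewrite subr0 normr_id.
  pose m := rnorm x + rnorm y + 1.
  have m0 : 0 < m by rewrite ltr_wpDl// addr_ge0 ?rnorm_ge0.
  have c0 : 0 < e / m by rewrite divr_gt0.
  have [N hN] := hZ x _ c0; have [N' hN'] := hZ y _ c0.
  pose k := maxn N N'.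
  have {hN} h1 := hN k (leq_maxl _ _); have {hN'} h2 := hN' k (leq_maxr _ _).
  have -> : hdot (Z x) y - hdot x (Z y) = hdot x (Y k y - Z y) - hdot (Y k x - Z x) y.
    by rewrite hdotBl hdotBr sqrt_iter_sym; ring.
  apply: le_trans (ler_normB _ _) _.
  apply: le_trans (lerD (hdot_rnorm _ _) (hdot_rnorm _ _)) _.
  have eE : e = rnorm x * (e / m) + e / m * rnorm y + e / m.
    by rewrite -[LHS](@divfK _ m) ?gt_eqF// /m; ring.
  rewrite -rmorphD lecR /= [leRHS]eE -[leLHS]addr0.
  by rewrite lerD ?(ltW c0)// lerD ?ler_wpM2l ?ler_wpM2r ?rnorm_ge0.
have Zeq x : Z x = (2^-1 : R)%:C *: (B x + Z (Z x)).
  have : ncvg (fun k => Y k.+1 x) (Z x).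
    by move=> e /(hZ x)[N hN]; exists N => k hk; apply: hN; exact: leqW.
  move=> /ncvg_uniq; apply; apply: ncvgZ; apply: (ncvg_squeeze (hZ x) (hZ (Z x))) => k.
  rewrite opprD addrACA subrr add0r.
  rewrite -(subrKA (Y k (Z x))); apply: le_trans (rnormD _ _) _.
  by rewrite lerD// -(op_linB _ _ (sqrt_iter_lin k)).
have bZ : bounded_op Z.
  apply/bounded_opP; split=> //; exists 1 => // x.
  by rewrite mul1r -rnorm_leq.
exists (fun x => x - Z x); split; last first.
  move=> x; rewrite (op_linB _ _ Zlin).
  have h2 : Z x + Z x = B x + Z (Z x).
    rewrite {1 2}Zeq -scalerDl -rmorphD /=.
    have -> : 2^-1 + 2^-1 = 1 :> R by field.
    by rewrite scale1r.
  have -> : B x = Z x + Z x - Z (Z x) by rewrite h2 addrK.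
  by rewrite !opprB opprD addrACA -!addrA.
split; first exact: bounded_opB (bounded_op_id _) bZ.
move=> x; rewrite hdotBl subr_ge0.
have zr : hdot (Z x) x \is Num.real.
  by rewrite CrealE -hdotC Zsym.
apply: le_trans (real_ler_norm zr) _; apply: le_trans (hdot_rnorm _ _) _.
rewrite hdot_nsq lecR -rnorm_sq expr2 ler_wpM2r ?rnorm_ge0//.
Qed.

End SquareRoot.

(** Rescaling by a bound [M] of the form of [A] reduces to [A = 1 - B] with
    [B] a positive contraction. *)
Lemma op_sqrtP (R : realType) (H : hilbertType R) (A : H -> H) : positive_op A ->
  positive_op (op_sqrt A) /\ forall x, op_sqrt A (op_sqrt A x) = A x.
Proof.
move=> pA; have [M M0 hM] := bounded_qform pA.1.
pose B x := x - (M^-1)%:C *: A x.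
have qB x : hdot (B x) x = (nsq x - M^-1 * qform A x)%:C.
  by rewrite hdotBl hdotZl (pos_qform _ pA) hdot_nsq rmorphB rmorphM.
have pB : positive_op B.
  split; first exact: bounded_opB (bounded_op_id _) (bounded_opZ _ pA.1).
  by move=> x; rewrite qB lecR subr_ge0 ler_pdivrMl.
have qB' x : qform B x = nsq x - M^-1 * qform A x by rewrite /qform qB.
have qB1 x : qform B x <= 1 * nsq x.
  by rewrite qB' mul1r gerBl mulr_ge0 ?invr_ge0 ?(ltW M0)// pos_qform_ge0.
have B1 x : nsq (B x) <= nsq x.
  apply: le_trans (pos_nsq_le pB ltr01 qB1 x) _; rewrite mul1r.
  by apply: le_trans (qB1 x) _; rewrite mul1r.
have [S [pS hS]] := sqrt_contraction pB B1.
have s0 : 0 <= Num.sqrt M by exact: sqrtr_ge0.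
have ex : exists S, positive_op S /\ S \o S = A.
  exists (fun x => (Num.sqrt M)%:C *: S x); split.
    split; first exact: bounded_opZ pS.1.
    by move=> x; rewrite hdotZl mulr_ge0 ?lecR//; exact: pS.2.
  apply/funext => x /=; rewrite (op_linZ _ _ pS.1.1) scalerA -rmorphM /= hS.
  rewrite -expr2 sqr_sqrtr ?(ltW M0)// /B opprB addrC subrK scalerA -rmorphM /=.
  by rewrite divff ?gt_eqF// scale1r.
have [h1 h2] := @getPex _ [set S : H -> H | positive_op S /\ S \o S = A] ex.
by split=> // x; rewrite -[RHS](congr1 (@^~ x) h2).
Qed.

(** * Nonnegative sums and convolution over words *)

Section NonnegativeSums.
Variable R : realType.
Local Open Scope ereal_scope.

Lemma fset_le_esum (I : choiceType) (g : I -> \bar R) (J : {fset I}) :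
  \sum_(i <- J) g i <= \esum_(i in [set: I]) g i.
Proof.
apply: esum_ge; exists [set` J]; first by split.
by rewrite fsbig_finite//= set_fsetK.
Qed.

Lemma esum_leP (I : choiceType) (g : I -> \bar R) (M : \bar R) :
  (forall J : {fset I}, \sum_(i <- J) g i <= M) <-> \esum_(i in [set: I]) g i <= M.
Proof.
split=> [h|h J]; last exact: le_trans (fset_le_esum _ _) h.
by apply: ge_ereal_sup => _ [X [fX _] <-]; rewrite fsbig_finite.
Qed.

Lemma esum_exchange (I J : choiceType) (a : I -> J -> \bar R) :
  (forall i j, 0 <= a i j) ->
  \esum_(i in [set: I]) \esum_(j in [set: J]) a i j =
  \esum_(j in [set: J]) \esum_(i in [set: I]) a i j.
Proof.
move=> a0; rewrite !esum_esum//.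
rewrite (reindex_esum ([set: J] `*`` (fun=> [set: I])) _ (fun p => (p.2, p.1)))//.
split=> // [[i j] [i' j'] _ _ [-> ->]//|[i j] _].
by exists (j, i).
Qed.

Lemma esumZ (I : choiceType) (c : R) (g : I -> \bar R) : (0 <= c)%R ->
  (forall i, 0 <= g i) ->
  \esum_(i in [set: I]) (c%:E * g i) = c%:E * \esum_(i in [set: I]) g i.
Proof.
have le d (h : I -> \bar R) : (0 < d)%R -> (forall i, 0 <= h i) ->
    \esum_(i in [set: I]) (d%:E * h i) <= d%:E * \esum_(i in [set: I]) h i.
  move=> d0 h0; apply/esum_leP => J; rewrite -ge0_sume_distrr//.
  by rewrite lee_pmul2l// fset_le_esum.
rewrite le_eqVlt => /predU1P[<- _|c0 g0].
  by rewrite mul0e esum1// => i _; rewrite mul0e.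
apply/eqP; rewrite eq_le le//= -lee_pdivlMl//.
have ci : (0 < c^-1)%R by rewrite invr_gt0.
apply: le_trans (le _ _ ci _); last by move=> i; rewrite mule_ge0// lee_fin ltW.
by apply: le_esum => i _; rewrite muleA -EFinM mulVf ?mul1e// gt_eqF.
Qed.

Lemma esum_ord (n : nat) (g : nat -> \bar R) : (forall i, 0 <= g i) ->
  \esum_(i in `I_n) g i = \sum_(i < n) g i.
Proof. by move=> g0; rewrite esum_fset// -fsbig_ord. Qed.

Lemma esum_nat_finite (n : nat) (g : nat -> \bar R) : (forall i, 0 <= g i) ->
  (forall i, (n <= i)%N -> g i = 0) ->
  \esum_(i in [set: nat]) g i = \sum_(i < n) g i.
Proof.
move=> g0 gn; rewrite -esum_ord// [RHS]esum_mkcond; apply: eq_esum => i _.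
case: ifPn => // /negP h; apply: gn; rewrite leqNgt; apply/negP => ni.
by apply: h; rewrite inE.
Qed.

(** Both sides are the supremum of the finite partial sums. This turns the
    limits that define inner products in [l2] and weak operator sums into sums
    whose order can be exchanged. *)
Lemma esum_of_cvg (I : choiceType) (g : I -> R) (l : R[i]) :
  (forall i, 0 <= g i)%R ->
  summability.partial_sum (fun i => (g i)%:C) @ summability.totally --> l ->
  \esum_(i in [set: I]) (g i)%:E = (complex.Re l)%:E.
Proof.
move=> g0 hl.
have cv : cvg (summability.partial_sum (fun i => (g i)%:C) @ summability.totally).
  by apply/cvg_ex; exists l.
have sl : summability.sum (fun i => (g i)%:C) = l by exact: cvg_lim hl.
have le (J : {fset I}) : (\sum_(i <- J) g i <= complex.Re l)%R.
  have := @sum_ge R I (fun i => (g i)%:C) J _ cv; rewrite sl -rmorph_sum /=.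
  have h i : (0 <= (g i)%:C)%R by rewrite lecR.
  by move=> /(_ h); rewrite lecE => /andP[].
have le1 : \esum_(i in [set: I]) (g i)%:E <= (complex.Re l)%:E.
  by apply/esum_leP => J; rewrite sumEFin lee_fin.
have ge0 : 0 <= \esum_(i in [set: I]) (g i)%:E by apply: esum_ge0 => i _; rewrite lee_fin.
apply/eqP; rewrite eq_le le1 /=.
have fin : \esum_(i in [set: I]) (g i)%:E \is a fin_num.
  by rewrite ge0_fin_numE// (le_lt_trans le1)// ltry.
rewrite -(fineK fin) lee_fin; set r := fine _.
have := @sum_le R I (fun i => (g i)%:C) r%:C cv; rewrite sl => h.
have : (l <= r%:C)%R.
  apply: h => J; rewrite -rmorph_sum lecR /r -lee_fin fineK// -sumEFin.
  exact: fset_le_esum.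
by rewrite lecE => /andP[].
Qed.

Lemma hdot_l2_cvg (I : choiceType) (K : hilbertType R) (f g : l2 I K) :
  summability.partial_sum (fun i => hdot (f i) (g i) : R[i]) @ summability.totally
    --> (hdot f g : R[i]).
Proof.
have h : summability.partial_sum (fun i => hdot (f i) (g i) : R[i]) @ summability.totally
    --> (l2dot f g : R[i]) by exact: l2dot_cvg.
exact: h.
Qed.

Lemma nsq_esum (I : choiceType) (K : hilbertType R) (f : l2 I K) :
  \esum_(i in [set: I]) (nsq (f i))%:E = (nsq f)%:E.
Proof.
apply: esum_of_cvg; first by move=> i; exact: nsq_ge0.
have -> : (fun i => (nsq (f i))%:C) = (fun i => hdot (f i) (f i) : R[i]).
  by apply/funext => i; rewrite hdot_nsq.
exact: hdot_l2_cvg.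
Qed.

Lemma square_summableP (I : choiceType) (K : hilbertType R) (f : I -> K) (M : R) :
  \esum_(i in [set: I]) (nsq (f i))%:E <= M%:E -> f \in @l2_mem R I K.
Proof.
move=> /esum_leP h; apply/asboolP; exists M%:C => J.
under eq_bigr do rewrite norm_nsq.
by rewrite -rmorph_sum lecR -lee_fin -sumEFin; exact: h.
Qed.

(** Every [u j] is the sum of the decrements [v k] with [j <= k]; exchange the
    two sums. *)
Lemma esum_by_parts (u v c : nat -> R) :
  (forall j, 0 <= c j)%R -> (forall j, 0 <= v j)%R ->
  (forall j, v j = u j - u j.+1)%R -> u @ \oo --> (0 : R)%R ->
  \esum_(j in [set: nat]) (c j * u j)%:E =
  \esum_(k in [set: nat]) ((\sum_(j < k.+1) c j) * v k)%:E.
Proof.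
move=> c0 v0 vE u0.
have tail j : (u j)%:E = \esum_(k in [set: nat]) (if (j <= k)%N then v k else 0%R)%:E.
  rewrite -nneseries_esumT; last by move=> k; rewrite lee_fin; case: ifP.
  apply/esym/cvg_lim => //; under eq_fun do rewrite sumEFin.
  apply: cvg_EFin; first by apply: nearW.
  have -> : fine \o (fun n => (\sum_(0 <= k < n) (if (j <= k)%N then v k else 0%R))%:E) =
      (fun n => if (j <= n)%N then (u j - u n)%R else 0%R).
    apply/funext => n /=; elim: n => [|n IH].
      by rewrite big_nil; case: ifP => //; case: (j) => // _; rewrite subrr.
    rewrite big_nat_recr//= IH [X in _ = if X then _ else _]leq_eqVlt ltnS.
    have [->|] := eqVneq j n.+1; first by rewrite ltnn !addr0 subrr.
    move=> jn /=; case: ifP => h; last by rewrite addr0.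
    by rewrite vE addrA subrK.
  have : (fun n => (u j - u n)%R) @ \oo --> (u j - 0)%R.
    by apply: cvgB => //; exact: cvg_cst.
  rewrite subr0; apply: cvg_trans; apply: near_eq_cvg.
  by exists j => // n /= ->.
under eq_esum => j _.
  rewrite EFinM tail -esumZ//; last by move=> k; rewrite lee_fin; case: ifP.
  over.
rewrite esum_exchange; last first.
  by move=> j k; rewrite -EFinM lee_fin mulr_ge0//; case: ifP.
apply: eq_esum => k _; rewrite (@esum_nat_finite k.+1).
- under eq_bigr => j _ do rewrite -EFinM.
  rewrite sumEFin mulr_suml; congr (_%:E); apply: eq_bigr => j _.
  by rewrite -ltnS ltn_ord.
- by move=> j; rewrite -EFinM lee_fin mulr_ge0//; case: ifP.
- by move=> j kj; rewrite leqNgt kj mule0.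
Qed.

End NonnegativeSums.

Section Convolution.
Variables (R : realType) (n : nat).
Implicit Types (a c : word n -> R) (w : word n).

(** The coefficients of a product of two formal power series in noncommuting
    variables. *)
Definition wconv a c w : R := \sum_(k < (size w).+1) a (take k w) * c (drop k w).

Lemma wconv_ge0 a c w : (forall v, 0 <= a v) -> (forall v, 0 <= c v) -> 0 <= wconv a c w.
Proof. by move=> a0 c0; apply: sumr_ge0 => k _; rewrite mulr_ge0. Qed.

Lemma le_wconv a c c' w : (forall v, 0 <= a v) -> (forall v, c v <= c' v) ->
  wconv a c w <= wconv a c' w.
Proof. by move=> a0 h; apply: ler_sum => k _; rewrite ler_wpM2l. Qed.

(** A pair of words is the same as a word together with a place to cut it. *)
Lemma esum_conv a c (G : word n -> \bar R) :
  (forall v, 0 <= a v) -> (forall v, 0 <= c v) -> (forall v, 0 <= G v)%E ->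
  (\esum_(w in [set: word n]) ((a w)%:E * \esum_(v in [set: word n]) ((c v)%:E * G (w ++ v))) =
   \esum_(u in [set: word n]) ((wconv a c u)%:E * G u))%E.
Proof.
move=> a0 c0 G0.
have F0 w v : (0 <= (a w * c v)%:E * G (w ++ v))%E.
  by rewrite mule_ge0// lee_fin mulr_ge0.
transitivity (\esum_(w in [set: word n]) \esum_(v in [set: word n])
    ((a w * c v)%:E * G (w ++ v))%E).
  apply: eq_esum => w _; rewrite -esumZ//; last by move=> v; rewrite mule_ge0// lee_fin.
  by apply: eq_esum => v _; rewrite muleA EFinM.
transitivity (\esum_(u in [set: word n]) \esum_(k in `I_(size u).+1)
    ((a (take k u) * c (drop k u))%:E * G u)%E); last first.
  apply: eq_esum => u _.
  rewrite esum_ord; last by move=> k; rewrite mule_ge0// lee_fin mulr_ge0.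
  by rewrite /wconv -sumEFin ge0_sume_distrl// => k _; rewrite lee_fin mulr_ge0.
rewrite esum_esum// esum_esum; last first.
  by move=> u k _ _; rewrite mule_ge0// lee_fin mulr_ge0.
rewrite (reindex_esum ([set: word n] `*`` (fun u => `I_(size u).+1)) _
  (fun p => (take p.2 p.1, drop p.2 p.1))).
  by apply: eq_esum => -[u k] _ /=; rewrite cat_take_drop.
split=> [//|[u k] [u' k']|[w v] _].
  rewrite !inE /= !ltnS => -[_ ku] [_ ku'] [et ed].
  have e : u = u' by rewrite -(cat_take_drop k u) et ed cat_take_drop.
  rewrite -{}e in ku' et *.
  by move/(congr1 size): et; rewrite !size_takel// => ->.
exists (w ++ v, size w) => /=; last by rewrite take_size_cat// drop_size_cat.
by split=> //=; rewrite size_cat ltnS leq_addr.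
Qed.

End Convolution.

(** * Coefficients of powers of a noncommutative power series *)

Section Coefficients.
Variables (R : realType) (n : nat) (a : word n -> R).
Hypothesis a_ge0 : forall w, 0 <= a w.
Hypothesis a_nil : a [::] = 0.
Implicit Types w v : word n.

(** The coefficients of the [j]-th power of the series [a]. *)
Definition apow (j : nat) w : R := \sum_(v <- factorizations j w) \prod_(u <- v) a u.

Lemma apow0 w : apow 0 w = (w == [::])%:R.
Proof. by rewrite /apow; case: w => [|i w] /=; rewrite ?big_nil// big_seq1 big_nil. Qed.

Lemma apowS j w : apow j.+1 w = wconv a (apow j) w.
Proof.
rewrite /apow /= big_allpairs_dep /wconv.
rewrite -(big_mkord xpredT (fun k => a (take k w) * apow j (drop k w))).
rewrite big_ltn// take0 a_nil mul0r add0r /index_iota subn1 /=.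
by apply: eq_bigr => k _; rewrite mulr_sumr; apply: eq_bigr => v _; rewrite big_cons.
Qed.

Lemma apow_ge0 j w : 0 <= apow j w.
Proof. by apply: sumr_ge0 => v _; apply: prodr_ge0 => u _. Qed.

Lemma apow_gt_size j w : (size w < j)%N -> apow j w = 0.
Proof.
elim: j w => // j IH w; rewrite ltnS apowS => wj.
rewrite /wconv big1// => -[[|k] hk] _ /=; first by rewrite take0 a_nil mul0r.
rewrite IH ?mulr0// size_drop.
by move: hk wj; lia.
Qed.

(** The coefficients of the power series of [(1 - t)^-s]. For [s = 0] the
    truncated subtraction gives ['C(j - 1, j)], which is one for [j = 0] and
    zero for [j > 0], as it should. *)
Definition negbin (s j : nat) : nat := 'C(j + s - 1, j).

Lemma negbin0 s : negbin s 0 = 1%N.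
Proof. exact: bin0. Qed.

Lemma negbinS s j : negbin s.+1 j.+1 = (negbin s j.+1 + negbin s.+1 j)%N.
Proof. by rewrite /negbin !addnS !addSn !subn1 /= binS. Qed.

Lemma negbin_sum s k : \sum_(j < k.+1) (negbin s j)%:R = (negbin s.+1 k)%:R :> R.
Proof.
elim: k => [|k IH]; first by rewrite big_ord1 !negbin0.
by rewrite big_ord_recr /= IH negbinS natrD addrC.
Qed.

(** The coefficients of [(1 - a)^-s]. *)
Definition bb (s : nat) w : R := \sum_(j < (size w).+1) (negbin s j)%:R * apow j w.

Lemma bb_ext s w N : (size w < N)%N -> bb s w = \sum_(j < N) (negbin s j)%:R * apow j w.
Proof.
move=> h; rewrite -(big_mkord xpredT (fun j => (negbin s j)%:R * apow j w)).
rewrite (big_cat_nat (n := (size w).+1))//= [X in _ = X + _]big_mkord.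
rewrite [X in _ = _ + X]big_nat [X in _ = _ + X]big1 ?addr0//.
by move=> j /andP[wj _]; rewrite apow_gt_size// mulr0.
Qed.

Lemma bcoefE m w : (0 < m)%N -> bcoef a m w = bb m w.
Proof.
move=> m0; rewrite /bb big_ord_recl negbin0 apow0 mul1r.
case: w => [|i w]; first by rewrite big_ord0 addr0.
rewrite add0r /bcoef big_add1 big_mkord; apply: eq_bigr => j _.
rewrite -mulr_suml mulrC; congr (_%:R * _).
have -> : lift ord0 j = j.+1 :> nat by [].
rewrite /negbin -bin_sub; last by lia.
by congr 'C(_, _); lia.
Qed.

Lemma bb_ge0 s w : 0 <= bb s w.
Proof. by apply: sumr_ge0 => j _; rewrite mulr_ge0// apow_ge0. Qed.

Lemma bb_nil s : bb s [::] = 1.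
Proof. by rewrite /bb big_ord1 negbin0 apow0 mulr1. Qed.

(** This is [(1 - a)^-(s+1) = (1 - a)^-s + a (1 - a)^-(s+1)]. *)
Lemma bb_rec s w : bb s.+1 w = bb s w + wconv a (bb s.+1) w.
Proof.
have -> : wconv a (bb s.+1) w = \sum_(j < (size w).+1) (negbin s.+1 j)%:R * apow j.+1 w.
  rewrite /wconv; under eq_bigr => k _.
    rewrite (@bb_ext _ _ (size w).+1); last by rewrite size_drop ltnS leq_subr.
    rewrite mulr_sumr; over.
  rewrite exchange_big /=; apply: eq_bigr => j _; rewrite apowS mulr_sumr.
  by apply: eq_bigr => k _; rewrite mulrCA.
rewrite big_ord_recr /= apow_gt_size// mulr0 addr0 /bb !big_ord_recl !negbin0 -addrA.
congr (_ + _); rewrite -big_split /=; apply: eq_bigr => j _.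
by rewrite /bump /= add1n negbinS natrD mulrDl.
Qed.

Lemma wconv_bb_le s w : wconv a (bb s.+1) w <= bb s.+1 w.
Proof. by rewrite [leRHS]bb_rec lerDr bb_ge0. Qed.

Lemma bb_cons s i w : a [:: i] * bb s.+1 w <= bb s.+1 (i :: w).
Proof.
apply: le_trans (wconv_bb_le _ _); rewrite /wconv /= big_ord_recl big_ord_recl /=.
rewrite take0 drop0 addrCA lerDl addr_ge0// ?mulr_ge0 ?bb_ge0//.
by apply: sumr_ge0 => k _; rewrite mulr_ge0 ?bb_ge0.
Qed.

(** Prepending a letter [i] multiplies the coefficient by at least [a_i]. *)
Lemma bb_gt0 s w : (forall i, 0 < a [:: i]) -> (0 < s)%N -> 0 < bb s w.
Proof.
case: s => // s ai _; elim: w => [|i w IH]; first by rewrite bb_nil.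
by apply: lt_le_trans (bb_cons _ _ _); rewrite mulr_gt0.
Qed.

End Coefficients.

(** * Completely positive maps attached to a tuple *)

(** All operators into Hilbert direct sums are constructed from their
    components, in particular the backward shifts and the Poisson kernel. *)
Lemma l2_op_ex (R : realType) (I : choiceType) (H K : hilbertType R) (A : H -> I -> K) (M : R) :
  0 <= M -> (forall i c x y, A (c *: x + y) i = c *: A x i + A y i) ->
  (forall x, \esum_(i in [set: I]) (nsq (A x i))%:E <= (M * nsq x)%:E)%E ->
  exists V : H -> l2 I K, bounded_op V /\ forall x i, V x i = A x i.
Proof.
move=> M0 lA hA; exists (fun x => L2 (square_summableP (hA x))); split=> //.
apply/bounded_opP; split=> [c x y|].
  by apply: val_inj; apply/funext => i /=; rewrite lA.
by exists M => // x; rewrite -lee_fin -nsq_esum; exact: hA.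
Qed.

Section Tuples.
Variables (R : realType) (n : nat) (H : hilbertType R) (T : 'I_n -> H -> H).
Hypothesis bT : forall i, bounded_op (T i).
Implicit Types (w u v : word n) (x y : H).

Lemma opword_bounded w : bounded_op (opword T w).
Proof.
by elim: w => [|i w IH] /=; [exact: bounded_op_id|exact: bounded_op_comp].
Qed.

Lemma opword_cat (X : Type) (S : 'I_n -> X -> X) u v (x : X) :
  opword S (u ++ v) x = opword S u (opword S v x).
Proof. by elim: u => //= i u ->. Qed.

(** This is [T_w^*]; for a word it reverses the order of the letters. *)
Definition adjw w : H -> H := adjoint (opword T w).

Lemma adjwP w x y : hdot (opword T w x) y = hdot x (adjw w y).
Proof. by apply: adjointP; exact: opword_bounded. Qed.

Lemma adjw_nil x : adjw [::] x = x.
Proof. by rewrite /adjw /= adjoint_id. Qed.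

Lemma adjw_cons i w x : adjw (i :: w) x = adjw w (adjoint (T i) x).
Proof. by rewrite /adjw /= adjoint_comp//; exact: opword_bounded. Qed.

Lemma adjw_cat u v x : adjw (u ++ v) x = adjw v (adjw u x).
Proof. by elim: u x => [|i u IH] x /=; rewrite ?adjw_nil// !adjw_cons IH. Qed.

Lemma adjw_lin w : linear (adjw w).
Proof. by have [] := adjoint_bounded (opword_bounded w). Qed.

End Tuples.

Section PhiMap.
Variables (R : realType) (n : nat) (a : word n -> R).
Hypothesis a_ge0 : forall w, 0 <= a w.
Hypothesis a_nil : a [::] = 0.
Variables (H : hilbertType R) (T : 'I_n -> H -> H).
Hypothesis bT : forall i, bounded_op (T i).
Implicit Types (w u v : word n) (x y : H) (Y Z : H -> H).

Lemma Phi_term_dot Y w x y :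
  hdot (Phi_term a T Y w x) y = (a w)%:C * hdot (Y (adjw T w x)) (adjw T w y).
Proof. by rewrite /Phi_term hdotZl adjwP. Qed.

Lemma wot_sum_pos Y Z : positive_op Y -> wot_sum (Phi_term a T Y) Z -> positive_op Z.
Proof.
move=> pY [bZ hZ]; split=> // x; have h := hZ x x.
have -> : hdot (Z x) x = summability.sum (fun w => hdot (Phi_term a T Y w x) x : R[i]).
  by apply/esym/cvg_lim.
apply: le_trans (sum_ge fset0 _ _); first by rewrite big_seq_fset0.
  by move=> w; rewrite Phi_term_dot mulr_ge0 ?lecR//; exact: pY.2.
by apply/cvg_ex; exists (hdot (Z x) x).
Qed.

Lemma wot_sum_qform Y Z x : positive_op Y -> wot_sum (Phi_term a T Y) Z ->
  \esum_(w in [set: word n]) (a w * qform Y (adjw T w x))%:E = (qform Z x)%:E.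
Proof.
move=> pY [bZ hZ]; apply: esum_of_cvg.
  by move=> w; rewrite mulr_ge0// pos_qform_ge0.
have -> : (fun w => (a w * qform Y (adjw T w x))%:C) =
    (fun w => hdot (Phi_term a T Y w x) x : R[i]).
  by apply/funext => w; rewrite Phi_term_dot (pos_qform _ pY) rmorphM.
exact: hZ.
Qed.

Lemma positive_id : positive_op (@id H).
Proof. by split; [exact: bounded_op_id|move=> x; rewrite hdot_nsq lecR nsq_ge0]. Qed.

Section Convergent.
Hypothesis wT : wot_convergent a T.

(** With [V x] the family of the [sqrt a_w T_w^* x], which is bounded because
    the series of the [a_w T_w T_w^*] converges, the sum of the
    [a_w T_w Y T_w^*] is [V^* (1 (x) Y) V]. *)
Lemma Phi_ex Y : bounded_op Y -> exists Z, wot_sum (Phi_term a T Y) Z.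
Proof.
move=> bY; have [Z0 hZ0] := wT.
have pZ0 := wot_sum_pos positive_id hZ0.
have [M M0 hM] := bounded_qform pZ0.1.
have VA i (c : R[i]) x y : (Num.sqrt (a i))%:C *: adjw T i (c *: x + y) =
    c *: ((Num.sqrt (a i))%:C *: adjw T i x) + (Num.sqrt (a i))%:C *: adjw T i y.
  by rewrite (adjw_lin bT) scalerDr !scalerA mulrC.
have Vb x : (\esum_(w in [set: word n]) (nsq ((Num.sqrt (a w))%:C *: adjw T w x))%:E
    <= (M * nsq x)%:E)%E.
  apply: le_trans (_ : (qform Z0 x)%:E <= _)%E; last by rewrite lee_fin.
  rewrite -(wot_sum_qform x positive_id hZ0); apply: le_esum => w _.
  by rewrite nsqZr sqr_sqrtr// qform_id.
have [V [bV hV]] := l2_op_ex (ltW M0) VA Vb.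
have /bounded_opP[lY [N N0 hN]] := bY.
have YA w (c : R[i]) (f g : l2 (word n) H) : Y ((c *: f + g) w) = c *: Y (f w) + Y (g w).
  by rewrite -lY.
have Yb (f : l2 (word n) H) :
    (\esum_(w in [set: word n]) (nsq (Y (f w)))%:E <= (N * nsq f)%:E)%E.
  rewrite EFinM -nsq_esum -esumZ//; last by move=> w; rewrite lee_fin nsq_ge0.
  by apply: le_esum => w _; rewrite -EFinM lee_fin.
have [Y' [bY' hY']] := l2_op_ex N0 YA Yb.
exists (adjoint V \o (Y' \o V)); split.
  by apply: bounded_op_comp; [exact: adjoint_bounded|exact: bounded_op_comp].
move=> x y; rewrite /= adjointPr//.
have -> : (fun w => hdot (Phi_term a T Y w x) y : R[i]) =
    (fun w => hdot (Y' (V x) w) (V y w) : R[i]).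
  apply/funext => w; rewrite Phi_term_dot hY' !hV (op_linZ _ _ lY) hdotZl hdotZr.
  by rewrite conj_realC mulrA -rmorphM /= -expr2 sqr_sqrtr.
exact: hdot_l2_cvg.
Qed.

Lemma PhiP Y : bounded_op Y -> wot_sum (Phi_term a T Y) (Phi a T Y).
Proof. by move=> bY; have := getPex (Phi_ex bY). Qed.

Lemma Phi_bounded Y : bounded_op Y -> bounded_op (Phi a T Y).
Proof. by move=> /PhiP[]. Qed.

Lemma Phi_pos Y : positive_op Y -> positive_op (Phi a T Y).
Proof. by move=> pY; apply: (wot_sum_pos pY); apply: PhiP; exact: pY.1. Qed.

Lemma Phi_qform Y x : positive_op Y ->
  \esum_(w in [set: word n]) (a w * qform Y (adjw T w x))%:E = (qform (Phi a T Y) x)%:E.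
Proof. by move=> pY; apply: wot_sum_qform => //; apply: PhiP; exact: pY.1. Qed.

Lemma PhiB Y Z : bounded_op Y -> bounded_op Z ->
  Phi a T (fun x => Y x - Z x) = (fun x => Phi a T Y x - Phi a T Z x).
Proof.
move=> bY bZ; apply/funext => x; apply: hdot_extl => y.
have [_ /(_ x y) h] := PhiP (bounded_opB bY bZ).
have [_ /(_ x y) hY] := PhiP bY; have [_ /(_ x y) hZ] := PhiP bZ.
rewrite hdotBl; apply: (cvg_unique _ h); first exact: norm_hausdorff.
have -> : (fun w => hdot (Phi_term a T (fun x => Y x - Z x) w x) y : R[i]) =
   (fun w => (hdot (Phi_term a T Y w x) y : R[i]) - hdot (Phi_term a T Z w x) y).
  by apply/funext => w; rewrite !Phi_term_dot hdotBl mulrBr.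
have -> : summability.partial_sum
     (fun w => (hdot (Phi_term a T Y w x) y : R[i]) - hdot (Phi_term a T Z w x) y) =
   (fun J => summability.partial_sum (fun w => hdot (Phi_term a T Y w x) y : R[i]) J
     - summability.partial_sum (fun w => hdot (Phi_term a T Z w x) y : R[i]) J).
  by apply/funext => J; rewrite !partial_sumE sumrB.
exact: (cvgB hY hZ).
Qed.

Lemma iterPhi_bounded k Y : bounded_op Y -> bounded_op (iter k (Phi a T) Y).
Proof. by move=> bY; elim: k => //= k; exact: Phi_bounded. Qed.

Lemma iterPhi_pos k Y : positive_op Y -> positive_op (iter k (Phi a T) Y).
Proof. by move=> pY; elim: k => //= k; exact: Phi_pos. Qed.

Lemma iterPhiB k Y Z : bounded_op Y -> bounded_op Z ->
  iter k (Phi a T) (fun x => Y x - Z x) =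
  (fun x => iter k (Phi a T) Y x - iter k (Phi a T) Z x).
Proof.
by move=> bY bZ; elim: k => //= k ->; rewrite PhiB//; exact: iterPhi_bounded.
Qed.

Lemma esum_apow0 (G : word n -> R) : (forall w, 0 <= G w) ->
  \esum_(w in [set: word n]) (apow a 0 w * G w)%:E = (G [::])%:E.
Proof.
move=> G0; rewrite -(@esum_set1 _ _ [::] (fun w => (G w)%:E)) ?lee_fin//.
rewrite [RHS]esum_mkcond; apply: eq_esum => w _; rewrite apow0.
have [->|w0] := eqVneq w [::]; first by rewrite mul1r mem_set.
by rewrite mul0r memNset// => /eqP; rewrite (negbTE w0).
Qed.

Lemma iterPhi_qform k Y x : positive_op Y ->
  \esum_(w in [set: word n]) (apow a k w * qform Y (adjw T w x))%:E =
  (qform (iter k (Phi a T) Y) x)%:E.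
Proof.
move=> pY; elim: k x => [|k IH] x.
  by rewrite esum_apow0 ?adjw_nil// => w; exact: pos_qform_ge0.
rewrite iterS -(Phi_qform _ (iterPhi_pos k pY)).
under [RHS]eq_esum => w _.
  rewrite EFinM -IH; under eq_esum => v _ do rewrite -(adjw_cat bT) EFinM.
  over.
rewrite (esum_conv a_ge0 (apow_ge0 a_ge0 k) (G := fun u => (qform Y (adjw T u x))%:E)).
  by apply: eq_esum => w _; rewrite -EFinM apowS.
by move=> w; rewrite lee_fin; exact: pos_qform_ge0.
Qed.

Lemma defectS s : defect a T s.+1 = (fun x => defect a T s x - Phi a T (defect a T s) x).
Proof. by []. Qed.

Lemma defect_bounded s : bounded_op (defect a T s).
Proof.
elim: s => [|s IH]; first exact: bounded_op_id.
by rewrite defectS; apply: bounded_opB => //; exact: Phi_bounded.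
Qed.

End Convergent.

(** The numbers [u s j = <Phi^j ((id - Phi)^s (I)) x, x>] satisfy
    [u (s+1) j = u s j - u s (j+1)], and tend to zero with [j] by purity, so
    [u s j] is the sum of the later [u (s+1) k]: the geometric series inverts
    [id - Phi]. Doing this [m] times starting from [u 0 0 = |x|^2] produces the
    coefficients of [(1 - t)^-m]. *)
Lemma pure_reconstruction m x : nc_domain a m T -> pure_tuple a T ->
  \esum_(w in [set: word n]) (bb a m w * qform (defect a T m) (adjw T w x))%:E =
  (nsq x)%:E.
Proof.
move=> [_ wT pD] pT.
have {}pD s : (s <= m)%N -> positive_op (defect a T s).
  by case: s => [|s] sm; [exact: positive_id|exact: pD].
pose u s j := qform (iter j (Phi a T) (defect a T s)) x.
have u_ge0 s j : (s <= m)%N -> 0 <= u s j.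
  by move=> sm; apply: pos_qform_ge0; apply: iterPhi_pos => //; exact: pD.
have uS s j : u s.+1 j = u s j - u s j.+1.
  rewrite /u defectS iterPhiB//.
  - by rewrite -iterSr /qform hdotBl raddfB.
  - exact: defect_bounded.
  - by apply: Phi_bounded => //; exact: defect_bounded.
have u_le s j : (s <= m)%N -> u s j <= u 0%N j.
  elim: s => // s IH sm; apply: le_trans (IH (ltnW sm)).
  by rewrite uS gerBl u_ge0// ltnW.
have u0 : u 0%N @ \oo --> (0 : R).
  have h : (fun k => hdot (iter k (Phi a T) id x) x : R[i]) @ \oo --> (hdot 0 x : R[i]).
    by apply: hdot_cvgl; exact: pT.
  rewrite hdot0l in h.
  have qE j : (fun k => hdot (iter k (Phi a T) id x) x) j = (u 0%N j)%:C.
    by rewrite /u -pos_qform//; apply: iterPhi_pos => //; exact: positive_id.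
  apply/cvgrPdist_le => e e0.
  have e0' : 0 < e%:C by rewrite ltcR.
  move/cvgrPdist_le: h => /(_ _ e0'); apply: filterS => k.
  rewrite sub0r normrN => hk; rewrite sub0r normrN -lecR.
  apply: le_trans hk; have := qE k => /= ->.
  by rewrite !ger0_norm ?lecR ?u_ge0.
(* Each [(id - Phi)^s (I)] is at most [I], so purity controls all of them. *)
have us s : (s <= m)%N -> u s @ \oo --> (0 : R).
  move=> sm; apply: (squeeze_cvgr _ (cvg_cst 0) u0).
  by apply: nearW => j; rewrite u_ge0//= u_le.
have key s : (s <= m)%N ->
    \esum_(j in [set: nat]) ((negbin s j)%:R * u s j)%:E = (nsq x)%:E.
  elim: s => [_|s IH sm].
    rewrite (@esum_nat_finite _ 1).
    - by rewrite big_ord1 negbin0 mul1r.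
    - by move=> j; rewrite lee_fin mulr_ge0// u_ge0.
    - move=> [//|j] _; rewrite /negbin addn0 subn1 /= bin_small ?mul0r//.
  rewrite -(IH (ltnW sm)).
  rewrite (@esum_by_parts _ (u s) (u s.+1) (fun j => (negbin s j)%:R))//.
  - by apply: eq_esum => k _; rewrite negbin_sum.
  - by move=> j; rewrite u_ge0.
  - exact: us (ltnW sm).
rewrite -(key m (leqnn m)).
pose q w := qform (defect a T m) (adjw T w x).
have q0 w : 0 <= q w by apply: pos_qform_ge0; exact: pD.
have t0 j w : 0 <= apow a j w * q w.
  by apply: mulr_ge0; [exact: apow_ge0|exact: q0].
transitivity (\esum_(j in [set: nat]) \esum_(w in [set: word n])
    ((negbin m j)%:R * (apow a j w * q w))%:E); last first.
  apply: eq_esum => j _; rewrite EFinM -iterPhi_qform//; last exact: pD.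
  by rewrite -esumZ// => w; rewrite lee_fin; exact: t0.
rewrite esum_exchange; last by move=> j w; rewrite lee_fin mulr_ge0//; exact: t0.
apply: eq_esum => w _; rewrite (@esum_nat_finite _ (size w).+1).
- rewrite sumEFin /bb mulr_suml; congr (_%:E).
  by apply: eq_bigr => j _; rewrite mulrA.
- by move=> j; rewrite lee_fin mulr_ge0//; exact: t0.
- by move=> j wj; rewrite apow_gt_size// mul0r mulr0.
Qed.

End PhiMap.

(** * Weighted shifts and the universal model *)

Lemma conj_realM (R : realType) (r : R) (z : R[i]) :
  Num.conj (r%:C * z) = r%:C * Num.conj z.
Proof. by rewrite -[X in _ = X * _]conj_realC -rmorphM. Qed.

Section ClosedSpans.
Variables (R : realType) (H : hilbertType R).

(** The vectors orthogonal to [g] form a closed subspace. *)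
Lemma orth_cspan (A : set H) (g x : H) :
  (forall y, A y -> hdot y g = 0) -> cs_set (cspan A) x -> hdot x g = 0.
Proof.
move=> hA hx; have : closure (orth [set g]) x.
  apply: closureS hx => _ [s sA ->] _ ->; rewrite hdot_suml big_seq big1// => c /sA Ac.
  by rewrite hdotZl hA// mulr0.
by move=> /orth_closed; apply.
Qed.

Lemma cspan_gen (A : set H) x : A x -> cs_set (cspan A) x.
Proof.
move=> Ax; apply: subset_closure; exists [:: (1, x)]; last by rewrite big_seq1 scale1r.
by move=> c; rewrite inE => /eqP ->.
Qed.

Lemma ocompl_cspanP (A : set H) x :
  cs_set (ocompl (cs_set (cspan A))) x <-> forall y, A y -> hdot x y = 0.
Proof.
split=> [h y Ay|h y hy]; first by apply: h; exact: cspan_gen.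
rewrite hdotC (orth_cspan _ hy) ?rmorph0// => z Az.
by rewrite hdotC h// rmorph0.
Qed.

Lemma subsp_hdotE (S : csubspace H) (x y : subsp S) : hdot x y = hdot (val x) (val y).
Proof. by []. Qed.

Lemma subsp_val_lin (S : csubspace H) (c : R[i]) (x y : subsp S) :
  val (c *: x + y) = c *: val x + val y.
Proof. by []. Qed.

End ClosedSpans.

Section SquareSummable.
Variables (R : realType) (I : choiceType) (K : hilbertType R).

Lemma hdot_l2_unique (f g : l2 I K) (l : R[i]) :
  summability.partial_sum (fun i => hdot (f i) (g i) : R[i]) @ summability.totally --> l ->
  hdot f g = l.
Proof. by move=> h; exact: (cvg_unique (@norm_hausdorff _ _) (@hdot_l2_cvg _ _ _ f g) h). Qed.

Lemma hdot_single (f g : l2 I K) i : (forall j, j != i -> g j = 0) ->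
  hdot f g = hdot (f i) (g i).
Proof.
move=> h; apply: hdot_l2_unique.
apply: (cvg_near_cst (hdot (f i) (g i) : R[i])); exists [fset i]%fset => // J /= iJ.
rewrite partial_sumE (big_fsetD1 i) /=; last by rewrite -fsub1set.
rewrite big_seq big1 ?addr0// => j; rewrite !inE => /andP[ji _].
by rewrite h// hdot0r.
Qed.

Lemma l2_ext (f g : l2 I K) : (forall i, f i = g i) -> f = g.
Proof. by move=> h; apply: val_inj; apply/funext. Qed.

End SquareSummable.

Section BasisAndSlices.
Variables (R : realType) (I : choiceType) (K : hilbertType R).

Lemma l2_basisE (i j : I) : l2_basis R i j = (j == i)%:R. Proof. by []. Qed.

Lemma tensE (x : l2 I R[i]) (d : K) i : tens x d i = (x i : R[i]) *: d. Proof. by []. Qed.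

Lemma hdot_basis (f : l2 I R[i]) i : hdot f (l2_basis R i) = f i.
Proof.
rewrite (@hdot_single _ _ _ _ _ i); last by move=> j /negbTE ji; rewrite l2_basisE ji.
by rewrite l2_basisE eqxx -[LHS]/(f i * Num.conj 1) rmorph1 mulr1.
Qed.

Lemma hdot_tens_basis (f : l2 I K) i (k : K) :
  hdot f (tens (l2_basis R i) k) = hdot (f i) k.
Proof.
rewrite (@hdot_single _ _ _ _ _ i); last first.
  by move=> j /negbTE ji; rewrite tensE l2_basisE ji scale0r.
by rewrite tensE l2_basisE eqxx scale1r.
Qed.

(** Slicing along [k] is adjoint to tensoring with [k]; membership in
    [N (x) K] is tested on slices. *)
Lemma slice_ex (f : l2 I K) (k : K) :
  exists s : l2 I R[i], (forall i, s i = hdot (f i) k) /\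
    forall x : l2 I R[i], hdot f (tens x k) = hdot s x.
Proof.
have h : (\esum_(i in [set: I]) (nsq (hdot (f i) k : R[i]))%:E <= (nsq k * nsq f)%:E)%E.
  rewrite EFinM -nsq_esum -esumZ ?nsq_ge0//; last by move=> i; rewrite lee_fin nsq_ge0.
  apply: le_esum => i _; rewrite -EFinM lee_fin -lecR -norm_nsq mulrC.
  exact: hdot_CS_nsq.
exists (L2 (square_summableP h)); split=> // x.
apply: hdot_l2_unique.
have -> : (fun i => hdot (f i) (tens x k i) : R[i]) =
    (fun i => hdot (L2 (square_summableP h) i : R[i]) (x i : R[i])).
  by apply/funext => i /=; rewrite hdotZr mulrC.
exact: hdot_l2_cvg.
Qed.

End BasisAndSlices.

Section TensorId.
Variables (R : realType) (I : choiceType) (N : csubspace (l2 I R[i])) (K : hilbertType R).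

(** The difference of the adjoints of two candidates is orthogonal to all
    elementary tensors, whose closed span is the whole space. *)
Lemma tens_idE (A : subsp N -> subsp N) (C : subsp (htens N K) -> subsp (htens N K)) :
  bounded_op C -> (forall x d, C (etens x d) = etens (A x) d) -> tens_id A = C.
Proof.
move=> bC hC.
have [bD hD] := @getPex _ [set C : subsp (htens N K) -> subsp (htens N K) |
  bounded_op C /\ forall x d, C (etens x d) = etens (A x) d]
  (ex_intro _ C (conj bC hC)).
rewrite -/(tens_id A) in bD hD; set D := tens_id A in bD hD *.
apply/funext => f; apply: hdot_extl => z.
pose g := adjoint D z - adjoint C z.
have go x d : hdot (etens x d) g = 0.
  by rewrite hdotBr -!adjointP// hD hC subrr.
have g0 : hdot (val g) (val g) = 0.
  apply: (orth_cspan (A := [set tens (val x) d | x in [set: subsp N] & d in [set: K]])).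
    by move=> _ [x _ [d _ <-]]; move: (go x d); rewrite subsp_hdotE.
  exact: set_mem (valP g).
apply/eqP; rewrite -subr_eq0 !adjointP// -hdotBr -/g.
have -> : g = 0 by apply: val_inj; rewrite (hdot_eq0 g0).
by rewrite hdot0r.
Qed.

End TensorId.

Section Shift.
Variables (R : realType) (n : nat) (a : word n -> R) (ha : pos_regular a).
Variables (m : nat) (hm : (0 < m)%N).
Implicit Types (w u v : word n).

Let b w : R := bcoef a m w.

Lemma bcoef_gt0 w : 0 < b w.
Proof.
rewrite /b bcoefE//; apply: bb_gt0 => //; first exact: pos_regular_ge0.
- exact: pos_regular_nil.
- exact: pos_regular_gen.
Qed.

Lemma bcoef_nil : b [::] = 1. Proof. by []. Qed.

(** The weights: [W_i e_w = cshift i w e_(i w)]. *)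
Definition cshift (i : 'I_n) w : R := Num.sqrt (b w / b (i :: w)).

(** The vector [W_w (1)] is [dcoef w e_w]. *)
Definition dcoef w : R := Num.sqrt (b w)^-1.

(** Because [b_(i w) >= a_i b_w]. *)
Lemma cshift_sq_le i w : cshift i w ^+ 2 <= (a [:: i])^-1.
Proof.
have ai := pos_regular_gen ha i.
have h := bcoef_gt0 w; have h' := bcoef_gt0 (i :: w).
rewrite sqr_sqrtr ?divr_ge0 ?(ltW h) ?(ltW h')// ler_pdivrMr// ler_pdivlMl//.
rewrite /b !bcoefE//; case: (m) hm => // m' _; apply: bb_cons.
  exact: pos_regular_ge0.
exact: pos_regular_nil.
Qed.

Lemma dcoef_cons i w : dcoef w * cshift i w = dcoef (i :: w).
Proof.
have h := bcoef_gt0 w; have h' := bcoef_gt0 (i :: w).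
rewrite /dcoef /cshift -sqrtrM ?invr_ge0 ?(ltW h)//.
by rewrite mulrA mulVf ?mul1r// gt_eqF.
Qed.

Section BackwardShift.
Variable K : hilbertType R.

Lemma bshift_ex i : exists V : l2 (word n) K -> l2 (word n) K,
  bounded_op V /\ forall f w, V f w = (cshift i w)%:C *: f (i :: w).
Proof.
apply: (l2_op_ex (M := (a [:: i])^-1)).
- by rewrite invr_ge0 pos_regular_ge0.
- by move=> w c f g /=; rewrite scalerDr !scalerA mulrC.
move=> f; have a0 : 0 <= (a [:: i])^-1 by rewrite invr_ge0 pos_regular_ge0.
apply: le_trans (_ : \esum_(w in [set: word n]) ((a [:: i])^-1%:E * (nsq (f (i :: w)))%:E) <= _)%E.
  apply: le_esum => w _; rewrite nsqZr -EFinM lee_fin ler_wpM2r ?nsq_ge0//.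
  exact: cshift_sq_le.
rewrite esumZ//; last by move=> w; rewrite lee_fin nsq_ge0.
rewrite EFinM lee_wpmul2l ?lee_fin// -nsq_esum.
rewrite -(@esum_image _ _ _ [set: word n] (cons i) (fun w => (nsq (f w))%:E)); last first.
  by move=> u v _ _ [].
rewrite [leLHS]esum_mkcond; apply: le_esum => w _.
by case: ifP => // _; rewrite lee_fin nsq_ge0.
Qed.

(** The adjoint [W_i^* (x) 1] of the weighted creation operator. *)
Definition bshift i : l2 (word n) K -> l2 (word n) K := sval (cid (bshift_ex i)).

Lemma bshift_bounded i : bounded_op (bshift i).
Proof. by rewrite /bshift; case: cid => V []. Qed.

Lemma bshiftE i f w : bshift i f w = (cshift i w)%:C *: f (i :: w).
Proof. by rewrite /bshift; case: cid => V []. Qed.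

End BackwardShift.

(** The adjoint of the backward shift on [l2(words)] has the required values. *)
Lemma wshiftP i : bounded_op (wshift a m i) /\
  forall w, wshift a m i (l2_basis R w) = (cshift i w)%:C *: l2_basis R (i :: w).
Proof.
apply: (@getPex _ [set A : fock R n -> fock R n | bounded_op A /\ forall w,
    A (l2_basis R w) = (cshift i w)%:C *: l2_basis R (i :: w)]).
exists (adjoint (@bshift R[i] i)); split.
  by apply: adjoint_bounded; exact: bshift_bounded.
move=> w; apply: l2_ext => v; rewrite -hdot_basis adjointPr; last exact: bshift_bounded.
rewrite hdotC hdot_basis bshiftE.
rewrite -[LHS]/(Num.conj ((cshift i w)%:C * l2_basis R v (i :: w))) conj_realM.
by rewrite -[RHS]/((cshift i w)%:C * l2_basis R (i :: w) v) !l2_basisE conjC_nat eq_sym.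
Qed.

Lemma wshift_bounded i : bounded_op (wshift a m i).
Proof. by case: (wshiftP i). Qed.

Lemma adjoint_wshift i : adjoint (wshift a m i) = @bshift R[i] i.
Proof.
apply/funext => f; apply: l2_ext => w.
rewrite -hdot_basis adjointPr; last exact: wshift_bounded.
have [_ ->] := wshiftP i; rewrite hdotZr conj_realC hdot_basis bshiftE.
by [].
Qed.

(** The weights [cshift] telescope along the word [w]. *)
Lemma intertwine_adjw (H K : hilbertType R) (T : 'I_n -> H -> H) (V : H -> l2 (word n) K) :
  (forall i, bounded_op (T i)) ->
  (forall i x, V (adjoint (T i) x) = bshift i (V x)) ->
  forall w x v, V (adjw T w x) v = (Num.sqrt (b v / b (w ++ v)))%:C *: V x (w ++ v).
Proof.
move=> bT hV; elim=> [|i w IH] x v.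
  by rewrite adjw_nil /= divff ?gt_eqF ?bcoef_gt0// sqrtr1 scale1r.
rewrite adjw_cons// IH hV bshiftE scalerA -rmorphM /= -sqrtrM; last first.
  by rewrite divr_ge0 // ltW ?bcoef_gt0.
by rewrite mulrA divfK// gt_eqF// bcoef_gt0.
Qed.

Variable P : set (ncpoly R n).

(** The coefficientwise form of the orthogonality to all
    [W_u p(W) W_v (1)]. *)
Definition in_variety (K : hilbertType R) (f : l2 (word n) K) : Prop :=
  forall p u v, P p ->
  \sum_(w <- finsupp p) (Num.conj (p w) * (dcoef (u ++ w ++ v))%:C) *: f (u ++ w ++ v) = 0.

Lemma N_subP (x : fock R n) : cs_set (N_sub a m P) x <-> in_variety x.
Proof.
have key p u v : hdot x (opword (wshift a m) u (nceval (wshift a m) p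
    (opword (wshift a m) v (l2_basis R [::])))) =
  \sum_(w <- finsupp p) (Num.conj (p w) * (dcoef (u ++ w ++ v))%:C) * x (u ++ w ++ v).
  have lW : linear (opword (wshift a m) u).
    by case: (opword_bounded wshift_bounded u).
  rewrite /nceval (op_lin_sum _ _ lW) hdot_sumr; apply: eq_bigr => w _.
  rewrite (op_linZ _ _ lW) -!opword_cat hdotZr hdotC (adjwP wshift_bounded) -hdotC.
  rewrite hdot_basis (@intertwine_adjw _ _ _ id wshift_bounded) => [|i y]; last first.
    by rewrite adjoint_wshift.
  by rewrite cats0 -catA bcoef_nil div1r -[RHS]mulrA.
rewrite ocompl_cspanP; split=> [h p u v Pp|h _ [p [u [v [Pp ->]]]]].
  by rewrite -[LHS]key; apply: h; exists p, u, v.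
by rewrite key; exact: h.
Qed.

(** The equations for [bshift i f] at [u] are those for [f] at [i u], as
    [W_i] maps the closed span [M] into itself. *)
Lemma in_variety_bshift (K : hilbertType R) (f : l2 (word n) K) i :
  in_variety f -> in_variety (bshift i f).
Proof.
move=> h p u v Pp; rewrite -[RHS](h p (i :: u) v Pp); apply: eq_bigr => w _.
by rewrite bshiftE scalerA -mulrA -rmorphM /= dcoef_cons.
Qed.

Section Tensor.
Variable K : hilbertType R.
Local Notation NK := (htens (N_sub a m P) K).

(** The equations are orthogonality relations, hence pass to closed spans. *)
Lemma in_variety_dot (f : l2 (word n) K) : in_variety f <->
  forall p u v k, P p -> hdot f (\sum_(w <- finsupp p)
     (p w * (dcoef (u ++ w ++ v))%:C) *: tens (l2_basis R (u ++ w ++ v)) k) = 0.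
Proof.
have e p u v k : hdot f (\sum_(w <- finsupp p)
     (p w * (dcoef (u ++ w ++ v))%:C) *: tens (l2_basis R (u ++ w ++ v)) k) =
   hdot (\sum_(w <- finsupp p) (Num.conj (p w) * (dcoef (u ++ w ++ v))%:C) *:
     f (u ++ w ++ v)) k.
  rewrite hdot_sumr hdot_suml; apply: eq_bigr => w _.
  rewrite hdotZr hdotZl hdot_tens_basis [X in Num.conj X]mulrC conj_realM.
  by rewrite [X in X * _ = _]mulrC.
split=> [h p u v k Pp|h p u v Pp]; first by rewrite e h// hdot0l.
by apply: hdot_extl => k; rewrite -e h// hdot0l.
Qed.

Lemma in_variety_tens (x : subsp (N_sub a m P)) (k : K) : in_variety (tens (val x) k).
Proof.
have /N_subP hx : cs_set (N_sub a m P) (val x) by exact: set_mem (valP x).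
move=> p u v Pp; have := congr1 ( *:%R^~ k) (hx p u v Pp).
rewrite /= scale0r scaler_suml => e; rewrite -[RHS]e.
by apply: eq_bigr => w _; rewrite scalerA.
Qed.

Lemma in_varietyB (f g : l2 (word n) K) :
  in_variety f -> in_variety g -> in_variety (f - g).
Proof.
move=> /in_variety_dot hf /in_variety_dot hg; apply/in_variety_dot => p u v k Pp.
by rewrite hdotBl hf// hg// subrr.
Qed.

(** An element of [l2 (x) K] satisfying the equations of the variety and
    orthogonal to [N (x) K] vanishes, because its slices lie in [N]. *)
Lemma htensP (f : l2 (word n) K) : cs_set NK f <-> in_variety f.
Proof.
have half g : cs_set NK g -> in_variety g.
  move=> hg; apply/in_variety_dot => p u v k Pp; apply: orth_cspan hg.
  by move=> _ [x _ [d _ <-]]; have /in_variety_dot := in_variety_tens x d; apply.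
split=> [|hf]; first exact: half.
pose p0 := orth_proj NK f; have Sp0 : cs_set NK (val p0) by exact: set_mem (valP p0).
have gv := in_varietyB hf (half _ Sp0).
set g := f - val p0 in gv.
have go x d : cs_set (N_sub a m P) x -> hdot g (tens x d) = 0.
  by move=> Nx; exact: (orth_projP (S := NK) f (etens (Subsp (mem_set Nx)) d)).
suff -> : f = val p0 by [].
apply/eqP; rewrite -subr_eq0 -/g; apply/eqP; apply: l2_ext => w.
apply: hdot_extl => d; have [s [sE hs]] := slice_ex g d.
have Ns : cs_set (N_sub a m P) s.
  apply/N_subP => p u v Pp.
  have := congr1 (fun z => hdot z d) (gv p u v Pp); rewrite hdot0l hdot_suml => e.
  by apply: etrans e; apply: eq_bigr => t _; rewrite hdotZl sE.
have s0 : s = 0 by apply: hdot_eq0; rewrite -hs go.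
by rewrite -sE s0 hdot0l.
Qed.

End Tensor.

Lemma N_bshift i (x : subsp (N_sub a m P)) : cs_set (N_sub a m P) (bshift i (val x)).
Proof. by apply/N_subP/in_variety_bshift/N_subP; exact: set_mem (valP x). Qed.

(** The compression [B_i] has for adjoint the restriction of [W_i^*], as [N]
    is invariant under it. *)
Lemma adjoint_universal_model i (x : subsp (N_sub a m P)) :
  val (adjoint (universal_model a m P i) x) = bshift i (val x).
Proof.
rewrite (@adjoint_uniq _ _ _ _ (fun x => Subsp (mem_set (N_bshift i x)))) // => y z.
rewrite !subsp_hdotE /= -adjoint_wshift -adjointP; last exact: wshift_bounded.
apply/eqP; rewrite -subr_eq0 -hdotBl -oppr_eq0 -[in X in _ == X]oppr0.
have := orth_projP (S := N_sub a m P) (wshift a m i (val y)) z.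
by rewrite !hdotBl => /eqP; rewrite subr_eq0 => /eqP ->; rewrite subrr !oppr0.
Qed.

Section TensorShift.
Variable K : hilbertType R.
Local Notation NK := (htens (N_sub a m P) K).

Lemma NK_bshift i (x : subsp NK) : cs_set NK (bshift i (val x)).
Proof. by apply/htensP/in_variety_bshift/htensP; exact: set_mem (valP x). Qed.

Lemma tens_id_universal_model i (f : subsp NK) :
  val (tens_id (adjoint (universal_model a m P i)) f) = bshift i (val f).
Proof.
have /bounded_opP[lS [M M0 hM]] := @bshift_bounded K i.
rewrite (@tens_idE _ _ _ _ _ (fun x => Subsp (mem_set (@NK_bshift i x)))) //.
  apply/bounded_opP; split=> [c x y|].
    by apply: val_inj; rewrite /= -lS.
  by exists M => // x; exact: hM.
move=> x d; apply: val_inj; apply: l2_ext => w /=.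
by rewrite bshiftE adjoint_universal_model bshiftE scalerA.
Qed.

End TensorShift.

End Shift.

(** * Pure tuples in the variety *)

Section Isometries.
Variables (R : realType) (H K : hilbertType R) (V : H -> K).
Hypothesis lV : linear V.
Hypothesis nV : forall x, nsq (V x) = nsq x.

Lemma isometry_bounded : bounded_op V.
Proof. by apply/bounded_opP; split=> //; exists 1 => // x; rewrite nV mul1r. Qed.

(** The form of [V^* V - 1] vanishes, so this operator is positive and
    [pos_nsq_le] bounds it by zero. *)
Lemma isometry_adjointK x : adjoint V (V x) = x.
Proof.
have bV := isometry_bounded; pose A x := adjoint V (V x) - x.
have A0 y : hdot (A y) y = 0.
  by rewrite hdotBl adjointPr// !hdot_nsq nV subrr.
have pA : positive_op A.
  split; last by move=> y; rewrite A0.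
  apply: bounded_opB (bounded_op_id _).
  exact: bounded_op_comp (adjoint_bounded bV) bV.
have qA y : qform A y = 0 by rewrite /qform A0.
have := pos_nsq_le pA ltr01 (fun y => _) x; rewrite qA mulr0 => h.
apply/eqP; rewrite -subr_eq0; apply/eqP/nsq_eq0/eqP.
rewrite eq_le nsq_ge0 andbT; apply: h => y.
by rewrite qA mulr_ge0 ?nsq_ge0.
Qed.

Lemma isometry_dot x y : hdot (V x) (V y) = hdot x y.
Proof. by rewrite adjointP ?isometry_adjointK//; exact: isometry_bounded. Qed.

(** The range of [V] is the kernel of the self-adjoint operator [1 - V V^*],
    the orthogonal complement of its range. *)
Lemma isometry_range : exists G : csubspace K, forall f, cs_set G f <-> exists x, f = V x.
Proof.
have bV := isometry_bounded.
exists (ocompl (range (fun f => f - V (adjoint V f)))) => f; split=> [hf|[x ->]].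
  exists (adjoint V f); apply: hdot_extl => g; apply/eqP.
  rewrite adjointP// -subr_eq0 adjointPr// -hdotBr; apply/eqP.
  by apply: hf; exists g.
by move=> _ [g _ <-]; rewrite hdotBr isometry_dot adjointP// subrr.
Qed.

End Isometries.

Lemma unitary_nsq (R : realType) (H K : hilbertType R) (U : H -> K) :
  unitary U -> forall x, nsq (U x) = nsq x.
Proof. by move=> [_ dU _] x; rewrite /nsq dU. Qed.

Section PureTuples.
Variables (R : realType) (n : nat) (a : word n -> R) (ha : pos_regular a).
Variables (m : nat) (hm : (0 < m)%N) (P : set (ncpoly R n)).
Variables (H : hilbertType R) (T : 'I_n -> H -> H) (bT : forall i, bounded_op (T i)).
Implicit Types (w u v : word n) (x y z : H).

Let a_ge0 : forall w, 0 <= a w := pos_regular_ge0 ha.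
Let a_nil : a [::] = 0 := pos_regular_nil ha.
Let b w : R := bcoef a m w.
Let b_gt0 w : 0 < b w := bcoef_gt0 ha hm w.

Lemma nceval_dot (p : ncpoly R n) x z :
  hdot (nceval T p x) z = hdot x (\sum_(w <- finsupp p) Num.conj (p w) *: adjw T w z).
Proof.
rewrite hdot_suml hdot_sumr; apply: eq_bigr => w _.
by rewrite hdotZl hdotZr conjCK adjwP.
Qed.

Section Dilation.
Hypothesis vT : nc_variety a m P T.
Hypothesis pT : pure_tuple a T.

Let D := defect_space a m T.

Lemma defect_pos : positive_op (defect a T m).
Proof. by case: vT => -[_ _ h] _; apply: h; rewrite hm leqnn. Qed.

Let S := op_sqrt (defect a T m).

Lemma defect_sqrt_mem x : S x \in cs_mem D.
Proof. by apply/mem_set/cspan_gen; exists x. Qed.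

(** The operator [Delta^(1/2)], with values in the space [D]. *)
Definition defect_sqrt x : subsp D := Subsp (defect_sqrt_mem x).

Lemma defect_sqrt_lin : linear defect_sqrt.
Proof.
have [[[lS _] _] _] := op_sqrtP defect_pos.
by move=> c x y; apply: val_inj; exact: lS.
Qed.

Lemma nsq_defect_sqrt x : nsq (defect_sqrt x) = qform (defect a T m) x.
Proof.
have [pS SS] := op_sqrtP defect_pos.
by rewrite /nsq subsp_hdotE /= -(pos_selfadjoint pS) SS.
Qed.

(** The noncommutative Poisson kernel, sending [x] to the sum of the
    [e_w (x) sqrt (b_w) Delta^(1/2) T_w^* x], is isometric by
    [pure_reconstruction]. *)
Lemma poisson_kernel_ex : exists V : H -> l2 (word n) (subsp D),
  [/\ bounded_op V, forall x w, V x w = (Num.sqrt (b w))%:C *: defect_sqrt (adjw T w x) &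
    forall x, nsq (V x) = nsq x].
Proof.
pose A x w := (Num.sqrt (b w))%:C *: defect_sqrt (adjw T w x).
have lA w (c : R[i]) x y : A (c *: x + y) w = c *: A x w + A y w.
  by rewrite /A (adjw_lin bT) defect_sqrt_lin scalerDr !scalerA mulrC.
have nA x : \esum_(w in [set: word n]) (nsq (A x w))%:E = (nsq x)%:E.
  have [dT _] := vT; rewrite -(pure_reconstruction a_ge0 a_nil bT x dT pT).
  apply: eq_esum => w _; rewrite nsqZr nsq_defect_sqrt sqr_sqrtr ?(ltW (b_gt0 w))//.
  by rewrite /b bcoefE.
have [|V [bV hV]] := @l2_op_ex _ _ _ _ A 1 ler01 lA.
  by move=> x; rewrite nA mul1r.
exists V; split=> // x; apply: EFin_inj; rewrite -nsq_esum -nA.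
by apply: eq_esum => w _; rewrite hV.
Qed.

(** The unitary is the Poisson kernel [V], with [G] its range; the equations
    of the variety for [V x] amount to [p(T)^* = 0] because the weights
    [dcoef w] cancel the factors [sqrt (b_w)]. *)
Lemma dilation_exists :
  exists (G : csubspace (subsp (htens (N_sub a m P) (subsp D)))) (U : H -> subsp G),
    [/\ unitary U,
        forall i, invariant_subspace G (tens_id (adjoint (universal_model a m P i))) &
        forall i x, adjoint (T i) x =
          adjoint U (restrict_op G (tens_id (adjoint (universal_model a m P i))) (U x))].
Proof.
have [V [bV hV nV]] := poisson_kernel_ex.
have iV i x : V (adjoint (T i) x) = bshift ha hm i (V x).
  apply: l2_ext => w; rewrite bshiftE !hV adjw_cons// scalerA -rmorphM /=.
  have h := b_gt0 (i :: w); rewrite -sqrtrM ?divr_ge0 ?(ltW (b_gt0 w)) ?(ltW h)//.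
  by rewrite divfK// gt_eqF.
have vV x : in_variety a m P (V x).
  move=> p u v Pp.
  have s0 y : \sum_(w <- finsupp p) Num.conj (p w) *: adjw T w y = 0.
    apply: hdot_eq0; rewrite -nceval_dot; case: vT => _ hp.
    by rewrite hp// hdot0l.
  transitivity (defect_sqrt (adjw T v
      (\sum_(w <- finsupp p) Num.conj (p w) *: adjw T w (adjw T u x)))).
    rewrite (op_lin_sum _ _ (adjw_lin bT v)) (op_lin_sum _ _ defect_sqrt_lin).
    apply: eq_bigr => w _; rewrite (op_linZ _ _ (adjw_lin bT v)).
    rewrite (op_linZ _ _ defect_sqrt_lin) hV !(adjw_cat bT) scalerA -mulrA -rmorphM /=.
    have h := b_gt0 (u ++ w ++ v).
    rewrite -sqrtrM ?invr_ge0 ?(ltW h)// mulVf ?gt_eqF// sqrtr1 mulr1.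
    by [].
  by rewrite s0 (op_lin0 (adjw_lin bT v)) (op_lin0 defect_sqrt_lin).
have mV x : V x \in cs_mem (htens (N_sub a m P) (subsp D)).
  by apply/mem_set/htensP.
pose V' x : subsp (htens (N_sub a m P) (subsp D)) := Subsp (mV x).
have lV' : linear V' by move=> c x y; apply: val_inj; exact: bV.1.
have nV' x : nsq (V' x) = nsq x by rewrite -nV.
have iV' i x : tens_id (adjoint (universal_model a m P i)) (V' x) = V' (adjoint (T i) x).
  by apply: val_inj; rewrite (tens_id_universal_model ha hm) /= iV.
have [G hG] := isometry_range lV' nV'.
have mU x : V' x \in cs_mem G by apply/mem_set/hG; exists x.
pose U x : subsp G := Subsp (mU x).
have lU : linear U by move=> c x y; apply: val_inj; exact: lV'.
have nU x : nsq (U x) = nsq x by rewrite -nV'.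
exists G, U; split.
- split=> //; first exact: isometry_dot.
  apply/seteqP; split=> // f _; have /hG[x hx] := set_mem (valP f).
  by exists x => //; apply: val_inj; rewrite /= -hx.
- by move=> i f /hG[x ->]; apply/hG; exists (adjoint (T i) x).
- move=> i x; have -> : restrict_op G (tens_id (adjoint (universal_model a m P i))) (U x)
      = U (adjoint (T i) x).
    by apply: val_inj; rewrite /restrict_op iV' insubdK.
  by rewrite isometry_adjointK.
Qed.

End Dilation.

(** Below, [V] is an isometry that identifies the [T_i^*] with restrictions of
    the backward shifts to a subspace of [N (x) K]. *)
Section Model.
Variables (K : hilbertType R) (V : H -> l2 (word n) K).
Hypothesis lV : linear V.
Hypothesis nV : forall x, nsq (V x) = nsq x.
Hypothesis iV : forall i x, V (adjoint (T i) x) = bshift ha hm i (V x).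
Hypothesis vV : forall x, in_variety a m P (V x).
Hypothesis wT : wot_convergent a T.

(** The vector [p(T)^* z] has under [V] the coordinates that the equations of
    the variety annihilate, up to the factors [sqrt (b_v)]. *)
Lemma model_variety (p : ncpoly R n) x : P p -> nceval T p x = 0.
Proof.
move=> Pp; apply: hdot_extl => z; rewrite nceval_dot hdot0l.
set y := \sum_(w <- finsupp p) _.
suff -> : y = 0 by rewrite hdot0r.
apply: nsq_eq0; rewrite -nV; suff -> : V y = 0 by rewrite nsq0.
apply: l2_ext => v; rewrite (op_lin_sum _ _ lV).
have -> : (\sum_(w <- finsupp p) V (Num.conj (p w) *: adjw T w z)) v =
    \sum_(w <- finsupp p) Num.conj (p w) *: V (adjw T w z) v.
  elim: (finsupp p : seq _) => [|w s IH]; first by rewrite !big_nil.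
  by rewrite !big_cons -IH (op_linZ _ _ lV).
have := congr1 ( *:%R (Num.sqrt (b v))%:C) (vV z [::] v Pp).
rewrite /= scaler0 scaler_sumr => e; rewrite -[RHS]e; apply: eq_bigr => w _.
rewrite (intertwine_adjw bT iV) !scalerA mulrCA -rmorphM /=.
by rewrite -sqrtrM ?(ltW (b_gt0 v)).
Qed.

(** The form at [V x] of the diagonal operator with entries [c_u / b_u]. *)
Definition diag_form (c : word n -> R) x : \bar R :=
  \esum_(u in [set: word n]) (c u / b u * nsq (V x u))%:E.

Lemma diag_form_id x : diag_form b x = (nsq x)%:E.
Proof.
rewrite -nV -nsq_esum; apply: eq_esum => u _.
by rewrite divff ?mul1r// gt_eqF.
Qed.

(** On diagonal operators, [Phi] multiplies the numerators by the series [a]: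
    the denominator [b_v] cancels against the weight of [T_w^*]. *)
Lemma Phi_diag Y (c : word n -> R) : positive_op Y -> (forall u, 0 <= c u) ->
  (forall x, (qform Y x)%:E = diag_form c x) ->
  forall x, (qform (Phi a T Y) x)%:E = diag_form (wconv a c) x.
Proof.
move=> pY c0 hY x; rewrite -(Phi_qform a_ge0 bT wT _ pY).
pose G u := (nsq (V x u) / b u)%:E.
have G0 u : (0 <= G u)%E by rewrite lee_fin divr_ge0 ?nsq_ge0// ltW.
transitivity (\esum_(w in [set: word n]) ((a w)%:E *
    \esum_(v in [set: word n]) ((c v)%:E * G (w ++ v))))%E.
  apply: eq_esum => w _; rewrite EFinM hY; congr (_ * _)%E; apply: eq_esum => v _.
  rewrite (intertwine_adjw bT iV) nsqZr sqr_sqrtr ?divr_ge0 ?ltW// -EFinM; congr (_%:E).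
  have h := b_gt0 v; have h' := b_gt0 (w ++ v); rewrite -/(b v) -/(b (w ++ v)).
  by field; rewrite !gt_eqF.
rewrite esum_conv//; apply: eq_esum => u _; rewrite -EFinM; congr (_%:E).
by rewrite mulrA mulrAC.
Qed.

(** By [bb_rec], each application of [id - Phi] lowers by one the exponent of
    [(1 - a)^-1] in the numerators, which are nonnegative down to exponent
    zero. *)
Lemma defect_diag s : (s <= m)%N -> positive_op (defect a T s) /\
  forall x, (qform (defect a T s) x)%:E = diag_form (bb a (m - s)) x.
Proof.
elim: s => [_|s IH sm].
  split=> [|x]; first exact: positive_id.
  rewrite subn0 -[LHS](diag_form_id x); apply: eq_esum => u _.
  by rewrite /b bcoefE.
have [pD hD] := IH (ltnW sm).
have pP := Phi_pos a_ge0 bT wT pD.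
have bb0 j u : 0 <= bb a j u by exact: bb_ge0.
have hP := Phi_diag pD (bb0 _) hD.
have g0 j x u : (0 <= (bb a j u / b u * nsq (V x u))%:E)%E.
  by rewrite lee_fin mulr_ge0 ?nsq_ge0// divr_ge0// ltW.
have E x : (qform (defect a T s) x)%:E =
    (diag_form (bb a (m - s.+1)) x + (qform (Phi a T (defect a T s)) x)%:E)%E.
  rewrite hD hP -esumD//.
    apply: eq_esum => u _; rewrite -EFinD -!mulrDl -(subnSK sm) -bb_rec//.
  move=> u _; rewrite lee_fin mulr_ge0 ?nsq_ge0// divr_ge0 ?(ltW (b_gt0 u))//.
  by apply: wconv_ge0.
have E' x : (qform (defect a T s.+1) x)%:E = diag_form (bb a (m - s.+1)) x.
  by rewrite defectS /qform hdotBl raddfB EFinB [X in (X - _)%E]E addeK.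
split=> //; split; first exact: defect_bounded.
move=> x; have -> : hdot (defect a T s.+1 x) x = (qform (defect a T s.+1) x)%:C.
  rewrite defectS /qform hdotBl (pos_qform _ pD) (pos_qform _ pP) -rmorphB.
  by [].
by rewrite lecR -lee_fin E'; apply: esum_ge0.
Qed.

Let ck (k : nat) : word n -> R := iter k (wconv a) b.

(** [b - a b = (1 - a)^-(m-1)] has nonnegative coefficients, and every factor
    [a] uses up at least one letter. *)
Lemma iter_wconv_bounds k u :
  [/\ 0 <= ck k u, ck k u <= b u & (size u < k)%N -> ck k u = 0].
Proof.
elim: k u => [|k IH] u; first by split=> //; exact: ltW.
split.
- by apply: wconv_ge0 => // v; case: (IH v).
- apply: le_trans (le_wconv (c' := b) u a_ge0 _) _; first by move=> v; case: (IH v).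
  have bE : b = bb a m by apply/funext => v; exact: bcoefE.
  by rewrite bE; case: (m) hm => // m' _; exact: wconv_bb_le.
rewrite ltnS => uk; rewrite /ck /= /wconv big1// => -[[|j] hj] _ /=.
  by rewrite take0 a_nil mul0r.
have [_ _ h] := IH (drop j.+1 u); rewrite -/(ck k) h ?mulr0//.
by rewrite size_drop; move: hj uk; lia.
Qed.

Lemma iterPhi_diag k x : (qform (iter k (Phi a T) id) x)%:E = diag_form (ck k) x.
Proof.
elim: k x => [|k IH] x; first by rewrite diag_form_id.
apply: Phi_diag => //; last by move=> u; case: (iter_wconv_bounds k u).
by apply: iterPhi_pos => //; exact: positive_id.
Qed.

(** Outside a finite set [J] of words the coordinates of [V x] have small
    norm, and for large [k] the diagonal entries vanish on [J]. *)
Lemma iterPhi_tail x (e : R) : 0 < e ->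
  exists N, forall k, (N <= k)%N -> qform (iter k (Phi a T) id) x <= e.
Proof.
move=> e0; pose g u := nsq (V x u).
have g0 u : 0 <= g u by exact: nsq_ge0.
have sg : \esum_(u in [set: word n]) (g u)%:E = (nsq x)%:E by rewrite nsq_esum nV.
have [J hJ] : exists J : {fset word n}, nsq x - e < \sum_(u <- J) g u.
  apply: contrapT => /forallNP h.
  have : (\esum_(u in [set: word n]) (g u)%:E <= (nsq x - e)%:E)%E.
    by apply/esum_leP => J; rewrite sumEFin lee_fin leNgt; apply/negP.
  by rewrite sg lee_fin lerBrDr gerDl leNgt e0.
exists (\max_(u <- J) (size u).+1)%N => k hk.
have small u : u \in J -> ck k u = 0.
  move=> uJ; have [_ _ ->] := iter_wconv_bounds k u => //.
  by apply: leq_trans hk; exact: (leq_bigmax_seq (F := fun u => (size u).+1)).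
rewrite -lee_fin iterPhi_diag.
pose h u := if u \in J then g u else 0.
have h0 u : 0 <= h u by rewrite /h; case: ifP.
have t0 u : 0 <= ck k u / b u * nsq (V x u).
  by case: (iter_wconv_bounds k u) => c0 _ _; rewrite mulr_ge0 ?nsq_ge0// divr_ge0// ltW.
have le1 : (diag_form (ck k) x + \esum_(u in [set: word n]) (h u)%:E <= (nsq x)%:E)%E.
  rewrite -esumD; [|by move=> u _; rewrite lee_fin..].
  rewrite -sg; apply: le_esum => u _; rewrite -EFinD lee_fin /h.
  case: ifP => [uJ|_]; first by rewrite small// !mul0r add0r.
  have [c0 c1 _] := iter_wconv_bounds k u; rewrite addr0 -[leRHS]mul1r ler_wpM2r ?nsq_ge0//.
  by rewrite ler_pdivrMr// mul1r.
have le2 : ((nsq x - e)%:E <= \esum_(u in [set: word n]) (h u)%:E)%E.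
  apply: le_trans (fset_le_esum _ J); rewrite sumEFin lee_fin.
  rewrite big_seq (eq_bigr g) => [|u uJ]; last by rewrite /h uJ.
  by rewrite -big_seq ltW.
have := le_trans (leeD (lexx (diag_form (ck k) x)) le2) le1.
by rewrite -leeBrDr// -EFinB opprB addrC subrK.
Qed.

(** For a positive contraction [Y], [|Y x|^2] is at most [<Y x, x>], so that
    weak convergence to zero is strong. *)
Lemma model_pure : pure_tuple a T.
Proof.
move=> x; apply/ncvgP => e e0.
have [N hN] := iterPhi_tail x (exprn_gt0 2 e0).
exists N => k /hN h; rewrite subr0.
rewrite -(@ler_pXn2r _ 2) ?nnegrE ?rnorm_ge0 ?(ltW e0)// rnorm_sq.
apply: le_trans h; rewrite -[leRHS]mul1r; apply: pos_nsq_le => //.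
  by apply: iterPhi_pos => //; exact: positive_id.
move=> y; rewrite mul1r -lee_fin iterPhi_diag -diag_form_id; apply: le_esum => u _.
have [c0 c1 _] := iter_wconv_bounds k u.
by rewrite lee_fin ler_wpM2r ?nsq_ge0// ler_wpM2r// invr_ge0 ltW.
Qed.

Lemma model_nc_variety : nc_variety a m P T.
Proof.
split=> [|p Pp x]; last exact: model_variety.
by split=> // s /andP[_ sm]; case: (defect_diag sm).
Qed.

End Model.

End PureTuples.

Theorem corollary3p4 (R : realType) (n m : nat) (hn : (0 < n)%N) (hm : (0 < m)%N)
  (a : word n -> R) (ha : pos_regular a)
  (P : set (ncpoly R n)) (hP : exists2 x, cs_set (N_sub a m P) x & x <> 0)
  (H : hilbertType R) (T : 'I_n -> H -> H) (hT : forall i, bounded_op (T i)) :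
  (nc_variety a m P T /\ pure_tuple a T)
  <->
  [/\ wot_convergent a T, positive_op (defect a T m) &
    exists (G : csubspace (subsp (htens (N_sub a m P) (subsp (defect_space a m T)))))
           (U : H -> subsp G),
      [/\ unitary U,
          forall i, invariant_subspace G (tens_id (adjoint (universal_model a m P i))) &
          forall i x, adjoint (T i) x =
            adjoint U (restrict_op G (tens_id (adjoint (universal_model a m P i))) (U x))]].
Proof.
split=> [[vT pT]|[wT pD [G [U [uU invG hU]]]]].
  split; [by case: vT => -[]|exact: defect_pos vT|exact: dilation_exists].
have nU := unitary_nsq uU; have [lU _ rU] := uU.
pose V x := val (val (U x)).
have lV : linear V by move=> c x y; rewrite /V lU !subsp_val_lin.
have nV x : nsq (V x) = nsq x by rewrite -nU.
have vV x : in_variety a m P (V x).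
  by apply/(htensP ha hm); exact: set_mem (valP (val (U x))).
have iV i x : V (adjoint (T i) x) = bshift ha hm i (V x).
  set r := restrict_op G (tens_id (adjoint (universal_model a m P i))) (U x).
  have [y _ hy] : range U r by rewrite rU.
  rewrite hU -/r -hy isometry_adjointK// /V hy -(tens_id_universal_model ha hm).
  rewrite /r /restrict_op insubdK//; apply/mem_set/invG.
  exact: set_mem (valP (U x)).
split; first exact: model_nc_variety vV wT.
exact: model_pure iV wT.
Qed.
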